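(* Let $\mathcal{F}=\{\mathcal{F}_i\}_{i\in I}$, $I\subset\mathbb{N}$, be an at most countable family of pairwise transverse foliations of the plane $\mathbb{R}^2$. Any two distinct ends of regular leaves of the same foliation $\mathcal{F}_i$ tend to two distinct points of $\mathbb{S}^1_{\mathcal{F}}$.
   Context: Foliations are non-singular one-dimensional topological foliations of $\mathbb{R}^2$ (all leaves are properly embedded lines); two foliations are transverse if locally simultaneously conjugate to the horizontal and vertical foliations. Two leaves of a foliation are not separated if they do not admit disjoint (saturated) neighborhoods; a leaf is regular if it is separated from every other leaf of the same foliation. An end of leaf is the germ at infinity of a half leaf (each leaf has two ends). A compactification of $\mathbb{R}^2$ by the closed disc $\mathbb{D}^2$ is a homeomorphism $\varphi:\mathbb{R}^2\to\mathring{\mathbb{D}}^2$; two are identified if $\varphi_2\circ\varphi_1^{-1}$ extends to a homeomorphism of $\mathbb{D}^2$. $\mathbb{D}^2_{\mathcal{F}}$, with boundary circle $\mathbb{S}^1_{\mathcal{F}}$, denotes the unique compactification such that every end of leaf of the $\mathcal{F}_i$ tends to a point of $\mathbb{S}^1_{\mathcal{F}}$, each point of $\mathbb{S}^1_{\mathcal{F}}$ is the limit of at most countably many ends of leaves, and for each non-empty open $O\subset\mathbb{S}^1_{\mathcal{F}}$ uncountably many ends of leaves have their limit in $O$. *)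

(* Defs.v *)
From HB Require Import structures.
From mathcomp Require Import all_boot all_order all_algebra.
From mathcomp Require Import all_classical all_reals all_analysis.

Set Implicit Arguments.
Unset Strict Implicit.
Unset Printing Implicit Defensive.

Import Order.TTheory GRing.Theory Num.Theory.
Import numFieldNormedType.Exports.

Local Open Scope classical_set_scope.
Local Open Scope ring_scope.

Notation plane R := (R * R)%type.

Section Foliations.
Context {R : realType}.
Implicit Types (F G : set (set (plane R))) (L H K U : set (plane R)).

Definition homeo_between (A B : set (plane R)) (h : plane R -> plane R) : Prop :=
  exists g : plane R -> plane R,
    [/\ {within A, continuous h}, {within B, continuous g},
        set_fun A B h, set_fun B A g &
        {in A, cancel h g} /\ {in B, cancel g h}].

(* [l] is a parametrization of a properly embedded line: a proper continuous
   injection of the real line into the (locally compact Hausdorff) plane is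
   automatically a homeomorphism onto its closed image. *)
Definition proper_line (l : R -> plane R) : Prop :=
  [/\ continuous l, injective l &
      forall C : set (plane R), compact C -> compact (l @^-1` C)].

(* The homeomorphism [h] of [U] onto the plane carries the foliation induced
   by [F] on [U], whose leaves are the connected components of the traces on
   [U] of the leaves of [F], to the foliation of the plane by the level lines
   of the coordinate [c]: horizontal lines for [c = snd], vertical lines for
   [c = fst]. *)
Definition straightens F U (h : plane R -> plane R) (c : plane R -> R) : Prop :=
  forall L, F L -> forall p, (L `&` U) p ->
    connected_component (L `&` U) p = U `&` [set q | c (h q) = c (h p)].

(* A foliation is given by its set of leaves. *)
Definition foliation F : Prop :=
  [/\ partition F id [set: plane R],
      forall L, F L -> exists2 l : R -> plane R, proper_line l & L = range l &
      forall p : plane R, exists U (h : plane R -> plane R),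
        [/\ open U, U p, homeo_between U setT h & straightens F U h snd]].

Definition transverse F G : Prop :=
  forall p : plane R, exists U (h : plane R -> plane R),
    [/\ open U, U p, homeo_between U setT h,
        straightens F U h snd & straightens G U h fst].

Definition saturated F U : Prop :=
  forall L, F L -> L `&` U !=set0 -> L `<=` U.

Definition separated_leaves F L1 L2 : Prop :=
  exists U1 U2, [/\ set_nbhs L1 U1, set_nbhs L2 U2,
                    saturated F U1, saturated F U2 & U1 `&` U2 = set0].

Definition regular_leaf F L : Prop :=
  F L /\ forall L', F L' -> L' <> L -> separated_leaves F L L'.

Definition half_leaf L H : Prop :=
  exists l : R -> plane R,
    [/\ proper_line l, L = range l & H = l @` [set t | 0 <= t]].

Definition same_germ L H1 H2 : Prop :=
  exists2 K, half_leaf L K & K `<=` H1 `&` H2.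

(* An end is represented by the class of all half leaves with a given germ at
   infinity, so that equality of ends is equality of germs. *)
Definition leaf_end L (e : set (set (plane R))) : Prop :=
  exists2 H, half_leaf L H & e = [set K | half_leaf L K /\ same_germ L H K].

Definition family_end (I : set nat) (F : nat -> set (set (plane R)))
    (e : set (set (plane R))) : Prop :=
  exists i L, [/\ I i, F i L & leaf_end L e].

Definition open_disc : set (plane R) := [set z | z.1 ^+ 2 + z.2 ^+ 2 < 1].
Definition circle : set (plane R) := [set z | z.1 ^+ 2 + z.2 ^+ 2 = 1].

Definition compactification (phi : plane R -> plane R) : Prop :=
  homeo_between setT open_disc phi.

(* The half leaves in [e] form a filter base; the end [e] tends to [x] when
   its image by [phi] converges to [x]. *)
Definition tends (phi : plane R -> plane R) (e : set (set (plane R)))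
    (x : plane R) : Prop :=
  phi @ filter_from e id --> x.

(* The properties characterizing, up to homeomorphism of the closed disc, the
   compactification D^2_F; its boundary circle S^1_F is [circle].  The non-empty
   open subsets of the circle are the [circle `&` V] that are non-empty with [V]
   open in the plane. *)
Definition family_compactification (I : set nat)
    (F : nat -> set (set (plane R))) (phi : plane R -> plane R) : Prop :=
  [/\ compactification phi,
      forall e, family_end I F e -> exists2 x, circle x & tends phi e x,
      forall x, circle x -> countable [set e | family_end I F e /\ tends phi e x] &
      forall V : set (plane R), open V -> circle `&` V !=set0 ->
        ~ countable [set e | family_end I F e /\
                             exists2 x, (circle `&` V) x & tends phi e x]].

End Foliations.

(* Main.v *)
(* A leaf L is a closed, locally flat, two-sided subset of the plane. Near each
   point its two sides are exchanged by crossing L, and since the plane has no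
   nontrivial double cover these local sides glue to a global function
   s : plane -> bool that is locally constant off L and jumps across L. With such
   functions the Jordan curve theorem is not needed.
   Suppose the ends e1 of L1 and e2 of L2 tend to the same point x of the circle,
   and let tau be a transversal through a point of L1. It suffices that every
   leaf through some interval of tau has an end at x: a transversal meets each
   leaf at most once, so uncountably many ends would tend to x.
   - If L1 = L2 = L, both ends of L tend to x, so s_L is constant near the circle
     minus x. Leaves on the other side of L can only go to x.
   - If L1 <> L2, regularity of L1 implies that the leaves close to L1, on one of
     its sides, separate L1 from L2. Such a leaf L must have an end at x, since
     otherwise s_L would be constant near x, where both L1 and L2 accumulate. *)

Require Import Defs.
From HB Require Import structures.
From mathcomp Require Import all_boot all_order all_algebra.
From mathcomp Require Import all_classical all_reals all_analysis.
From mathcomp Require Import ring lra.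
Import Order.TTheory GRing.Theory Num.Theory.
Import numFieldNormedType.Exports.

Local Open Scope classical_set_scope.
Local Open Scope ring_scope.

(** * Connectedness through local constancy, and convex subsets of the plane *)

Lemma connected_locally_constant (T : topologicalType) (U : Type) (A : set T)
    (f : T -> U) : connected A ->
  (forall q, A q -> \forall q' \near q, A q' -> f q' = f q) ->
  forall p q, A p -> A q -> f p = f q.
Proof.
move=> cA floc p q Ap Aq.
have : A `&` [set r | f r = f p] = A.
  apply: cA.
  - by exists p.
  (* The fibre of [f] through [p] is clopen in [A]. The implication [A r -> ...] leaves points
     outside [A] unconstrained, so that this interior is an open set of [T] whose trace on [A] is
     the fibre. *)
  - exists (interior [set r | A r -> f r = f p]); first exact: open_interior.
    apply/seteqP; split => r [Ar].
    + move=> frp; split => //; near=> r' => Ar'.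
      by rewrite /= in frp; rewrite -frp; move: Ar'; near: r'; exact: floc.
    + by move=> /interior_subset /(_ Ar).
  - exists (~` interior [set r | A r -> f r <> f p]).
      by rewrite closedC; exact: open_interior.
    apply/seteqP; split => r [Ar].
    + by move=> frp; split => // /interior_subset /(_ Ar).
    + move=> frp; split => //; apply: contrapT => nfr; apply: frp.
      near=> r' => Ar'.
      suff -> : f r' = f r by [].
      by move: Ar'; near: r'; exact: floc.
by move=> /seteqP[_ /(_ q Aq)[_ ->]].
Unshelve. all: by end_near. Qed.

Section Plane.
Context {R : realType}.
Implicit Types (p q : plane R) (A B L : set (plane R)).

Definition segment_point p q (t : R) : plane R :=
  (p.1 + t * (q.1 - p.1), p.2 + t * (q.2 - p.2)).

Lemma continuous_pairing (T : topologicalType) (f g : T -> R) :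
  continuous f -> continuous g -> continuous (fun t => (f t, g t)).
Proof. by move=> cf cg t; exact: (cvg_pair (cf t) (cg t)). Qed.

Lemma segment_point_continuous p q : continuous (segment_point p q).
Proof.
have affine (a b : R) : continuous (fun t : R => a + t * b).
  move=> t; apply: (@continuousD _ R R (fun=> a) (fun t : R => t * b)).
    exact: cvg_cst.
  by apply: (@continuousM _ R id (fun=> b)); [exact: cvg_id|exact: cvg_cst].
exact: continuous_pairing.
Qed.

Definition plane_convex A := forall p q (t : R), A p -> A q -> 0 <= t -> t <= 1 ->
  A (segment_point p q t).

Lemma plane_convex_connected A : plane_convex A -> connected A.
Proof.
move=> Acvx; have [->|/set0P[p Ap]] := eqVneq A set0; first exact: connected0.
have -> : A = \bigcup_(q in A) (segment_point p q @` `[0, 1]%classic).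
  apply/seteqP; split => [q Aq|r [q Aq] [t]] /=.
    exists q => //; exists 1; first by rewrite /= in_itv /= ler01 lexx.
    by rewrite /segment_point !mul1r !subrKC; case: (q).
  by rewrite in_itv /= => /andP[t0 t1] <-; exact: Acvx.
apply: bigcup_connected.
  exists p => q Aq; exists 0; first by rewrite /= in_itv /= lexx ler01.
  by rewrite /segment_point !mul0r !addr0; case: (p).
move=> q Aq; apply: connected_continuous_connected; first exact: segment_connected.
by apply: continuous_subspaceT; exact: segment_point_continuous.
Qed.

Definition rect (a b c d : R) : set (plane R) :=
  [set q | [/\ a < q.1, q.1 < b, c < q.2 & q.2 < d]].

Lemma rect_convex a b c d : plane_convex (rect a b c d).
Proof.
move=> p q t [p1 p2 p3 p4] [q1 q2 q3 q4] t0 t1; rewrite /segment_point.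
have gt (a' x y : R) : a' < x -> a' < y -> a' < x + t * (y - x).
  move=> ax ay; have [xy|/ltW yx] := leP x y; first nra.
  suff: y <= x + t * (y - x) by lra.
  nra.
have lt (a' x y : R) : x < a' -> y < a' -> x + t * (y - x) < a'.
  by move=> xa ya; have := gt (- a') (- x) (- y); lra.
by split => /=; [exact: gt|exact: lt|exact: gt|exact: lt].
Qed.

Lemma rect_open a b c d : open (rect a b c d).
Proof.
have -> : rect a b c d = (fst @^-1` `]a, b[%classic) `&` (snd @^-1` `]c, d[%classic).
  apply/seteqP; split => q /=; rewrite !in_itv /=.
    by move=> [-> -> -> ->].
  by move=> [/andP[? ?] /andP[? ?]].
apply: openI; apply: open_comp => //; try exact: interval_open.
  by move=> q _; exact: cvg_fst.
by move=> q _; exact: cvg_snd.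
Qed.

Lemma rect_nbhs p (N : set (plane R)) : nbhs p N ->
  exists2 e : R, 0 < e & rect (p.1 - e) (p.1 + e) (p.2 - e) (p.2 + e) `<=` N.
Proof.
move=> /nbhs_ballP[e /= e0 eN]; exists e => // q [q1 q2 q3 q4]; apply: eN.
by split; rewrite /ball /= ltr_distlC; apply/andP; split.
Qed.

Lemma rect_center p (e : R) : 0 < e ->
  rect (p.1 - e) (p.1 + e) (p.2 - e) (p.2 + e) p.
Proof. by move=> e0; split; lra. Qed.

End Plane.

(** * Side functions of locally flat sets *)

Section Sides.
Context {R : realType}.
Variable L : set (plane R).
Implicit Types (p q : plane R) (s : plane R -> bool).

(** [B1] and [B2] are the two local sides of [L]. Their connectedness makes a side function constant
    on each, and the closure clause lets one box serve at every point of [W] on [L], not only at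
    [p]. *)
Definition flat_box p (W B1 B2 : set (plane R)) : Prop :=
  [/\ [/\ open W, W p & W `<=` B1 `|` B2 `|` L],
      [/\ open B1, connected B1 & B1 `&` L = set0],
      [/\ open B2, connected B2 & B2 `&` L = set0],
      B1 `&` B2 = set0 &
      W `&` L `<=` closure B1 `&` closure B2].

Definition locally_flat : Prop := closed L /\
  forall p, L p -> forall N, nbhs p N -> exists W B1 B2 : set (plane R),
    [/\ flat_box p W B1 B2, B1 `<=` N & B2 `<=` N].

(* The values of [s] on [L] are junk. *)
Definition side_at s q : Prop :=
  (~ L q -> \forall q' \near q, s q' = s q) /\
  (L q -> forall N, nbhs q N ->
     exists a b, [/\ N a, N b, ~ L a, ~ L b & s a /\ ~~ s b]).

(** Only the values off [L] count, and exchanging the two sides preserves both clauses of [side_at].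
    The bit [c] records whether they are exchanged; it is the Z/2 ambiguity met in every gluing
    below. *)
Lemma side_at_near s s' (c : bool) q : closed L ->
  (\forall q' \near q, ~ L q' -> s q' = s' q' (+) c) ->
  side_at s' q -> side_at s q.
Proof.
move=> Lcl ss' [s'1 s'2]; split=> Lq.
  have ss'q : s q = s' q (+) c by apply: (nbhs_singleton ss').
  have nL : \forall q' \near q, ~ L q' by apply: open_nbhs_nbhs; split => //; exact: closed_openC.
  near=> q'; rewrite ss'q.
  have -> : s q' = s' q' (+) c.
    have : ~ L q' by near: q'.
    by near: q'.
  by congr (_ (+) _); near: q'; exact: s'1.
move=> N Nq.
have [a [b [[Na ha] [Nb hb] La Lb [sa sb]]]] := s'2 Lq _ (filterI Nq ss').
case: c ss' ha hb => ss' /(_ La) ha /(_ Lb) hb.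
  by exists b, a; rewrite ha hb sa (negbTE sb).
by exists a, b; rewrite ha hb sa (negbTE sb).
Unshelve. all: by end_near. Qed.

Lemma side_at_connected s A : (forall q, A q -> ~ L q /\ side_at s q) ->
  connected A -> forall p q, A p -> A q -> s p = s q.
Proof.
move=> sA cA; apply: connected_locally_constant => // q Aq.
have [nLq [/(_ nLq) h _]] := sA q Aq.
by near=> q' => _; near: q'.
Unshelve. all: by end_near. Qed.

(** Each side is connected and misses [L], so [s] is constant on it; the jump of [s] at [p] forces
    the two constants to differ. *)
Lemma flat_box_sides p W B1 B2 s : L p -> flat_box p W B1 B2 ->
  (forall q, B1 q \/ B2 q \/ q = p -> side_at s q) ->
  exists c : bool, (forall q, B1 q -> s q = c) /\ (forall q, B2 q -> s q = ~~ c).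
Proof.
move=> Lp [[oW Wp WB] [_ cB1 B1L] [_ cB2 B2L] _ _] sB.
have B1c q q' : B1 q -> B1 q' -> s q = s q'.
  apply: side_at_connected => // r B1r; split; last by apply: sB; left.
  by move=> Lr; have : (B1 `&` L) r by []; rewrite B1L.
have B2c q q' : B2 q -> B2 q' -> s q = s q'.
  apply: side_at_connected => // r B2r; split; last by apply: sB; right; left.
  by move=> Lr; have : (B2 `&` L) r by []; rewrite B2L.
have [_ /(_ Lp W)] : side_at s p by apply: sB; right; right.
have /[swap]/[apply] : nbhs p W by exact: open_nbhs_nbhs.
move=> [a [b [/WB Wa /WB Wb La Lb [sa sb]]]].
case: Wa => [[] Ba|//]; case: Wb => [[] Bb|//].
- by move: sb; rewrite (B1c _ _ Bb Ba) sa.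
- exists true; split => q Bq; first by rewrite (B1c _ _ Bq Ba).
  by rewrite (B2c _ _ Bq Bb) (negbTE sb).
- exists false; split => q Bq; first by rewrite (B1c _ _ Bq Bb) (negbTE sb).
  by rewrite (B2c _ _ Bq Ba) sa.
- by move: sb; rewrite (B2c _ _ Bb Ba) sa.
Qed.

Hypothesis L_flat : locally_flat.

Let L_closed : closed L. Proof. by case: L_flat. Qed.

Lemma flat_dense p N : nbhs p N -> exists2 a, N a & ~ L a.
Proof.
move=> Np; have [Lp|] := pselect (L p); last by exists p => //; exact: nbhs_singleton.
have [W [B1 [B2 [[[oW Wp _] [_ _ B1L] _ _ WL] _ _]]]] := L_flat.2 p Lp N Np.
have [/(_ _ Np) [a [B1a Na]] _] := WL p (conj Wp Lp).
by exists a => // La; have : (B1 `&` L) a by []; rewrite B1L.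
Qed.

(** The discrepancy between [s] and [s'] is locally constant, even across [L]: there both functions
    are negated, so that their exclusive or is unchanged. Connectedness of [O] concludes. *)
Lemma side_unique (O : set (plane R)) s s' : open O -> connected O ->
  (forall q, O q -> side_at s q) -> (forall q, O q -> side_at s' q) ->
  exists c : bool, forall q, O q -> ~ L q -> s q = s' q (+) c.
Proof.
move=> oO cO sO s'O.
have nO q : O q -> nbhs q O by move=> Oq; exact: open_nbhs_nbhs.
have loc q : exists c : bool, O q ->
    \forall q' \near q, O q' /\ (~ L q' -> s q' = s' q' (+) c).
  have [Oq|nOq] := pselect (O q); last by exists true.
  have [Lq|nLq] := pselect (L q).
    have [W [B1 [B2 [fb B1O B2O]]]] := L_flat.2 q Lq O (nO _ Oq).
    have BO r : B1 r \/ B2 r \/ r = q -> O r by move=> [/B1O|[/B2O|->]].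
    have [c [c1 c2]] := flat_box_sides _ _ _ _ _ Lq fb (fun r h => sO r (BO r h)).
    have [c' [c'1 c'2]] := flat_box_sides _ _ _ _ _ Lq fb (fun r h => s'O r (BO r h)).
    exists (c (+) c') => _.
    have [[oW Wq WB] _ _ _ _] := fb.
    have nW : nbhs q W by exact: open_nbhs_nbhs.
    near=> r.
    split; first by near: r; exact: nO.
    have : W r by near: r.
    move=> /WB[[] Br|//] _.
      by rewrite c1 // c'1 //; case: (c) (c') => [] [].
    by rewrite c2 // c'2 //; case: (c) (c') => [] [].
  exists (s q (+) s' q) => _.
  have h := (sO q Oq).1 nLq; have h' := (s'O q Oq).1 nLq.
  near=> r; split; first by near: r; exact: nO.
  move=> _; have -> : s r = s q by near: r.
  have -> : s' r = s' q by near: r.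
  by case: (s q) (s' q) => [] [].
have [c Hc] := choice loc.
have cloc q : O q -> \forall q' \near q, O q' -> c q' = c q.
  move=> Oq; have /nbhs_interior h := Hc q Oq.
  near=> q' => Oq'; have hq' := Hc q' Oq'.
  have hq : \forall r \near q', O r /\ (~ L r -> s r = s' r (+) c q) by near: q'.
  (* The bits [c q] and [c q'] are both read at one point [r] off [L], which exists because [L] has
     empty interior. *)
  have [r [[Or h1] [_ h2]] nLr] := flat_dense _ _ (filterI hq hq').
  have := h2 nLr; rewrite (h1 nLr).
  by case: (s' r) (c q) (c q') => [] [] [].
have [->|/set0P[p Op]] := eqVneq O set0; first by exists true.
exists (c p) => q Oq nLq.
rewrite (connected_locally_constant _ _ _ _ cO cloc p q Op Oq).
exact: (nbhs_singleton (Hc q Oq)).2.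
Unshelve. all: by end_near. Qed.

Lemma side_local p : exists (s : plane R -> bool) (e : R), 0 < e /\
  forall q, rect (p.1 - e) (p.1 + e) (p.2 - e) (p.2 + e) q -> side_at s q.
Proof.
suff [s] : exists s, \forall q \near p, side_at s q.
  by move=> /rect_nbhs[e e0 es]; exists s, e.
have [Lp|nLp] := pselect (L p).
  have [W [B1 [B2 [[[oW Wp WB] [oB1 _ B1L] [oB2 _ B2L] B12 WL] _ _]]]] :=
    L_flat.2 p Lp setT filterT.
  exists (fun q => `[< B1 q >]).
  have nW : nbhs p W by exact: open_nbhs_nbhs.
  near=> q; have Wq : W q by near: q.
  split => [nLq|Lq N Nq].
    have [[Bq|Bq]|//] := WB q Wq.
      have nB : nbhs q B1 by exact: open_nbhs_nbhs.
      by near=> r; rewrite !asboolT //; near: r.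
    have nB : nbhs q B2 by exact: open_nbhs_nbhs.
    have B2n r : B2 r -> ~ B1 r.
      by move=> B2r B1r; have : (B1 `&` B2) r by []; rewrite B12.
    near=> r; rewrite !asboolF //; first exact: B2n.
    by apply: B2n; near: r.
  have [/(_ _ Nq)[a [Ba Na]] /(_ _ Nq)[b [Bb Nb]]] := WL q (conj Wq Lq).
  exists a, b; split => //.
  - by move=> La; have : (B1 `&` L) a by []; rewrite B1L.
  - by move=> La; have : (B2 `&` L) b by []; rewrite B2L.
  - split; first by rewrite asboolT.
    by rewrite asboolF // => Bb'; have : (B1 `&` B2) b by []; rewrite B12.
exists (fun=> true).
have : \forall q \near p, ~ L q by apply: open_nbhs_nbhs; split => //; exact: closed_openC.
move=> nL; near=> q; have nLq : ~ L q by near: q.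
by split => // _; near=> q'.
Unshelve. all: by end_near. Qed.

End Sides.

(** * Gluing local sides into a function on the whole plane *)

Lemma interval_gluing {R : realType} (P : R -> R -> Prop) :
  (forall a b a' b', a <= a' -> b' <= b -> P a b -> P a' b') ->
  (forall x, exists2 e : R, 0 < e & P (x - e) (x + e)) ->
  (forall a b a' b', a <= a' -> a' < b -> b <= b' -> P a b -> P a' b' -> P a b') ->
  forall a b, a < b -> P a b.
Proof.
move=> Pmono Ploc Pglue a b ab.
(* Continuous induction: were the supremum of [A] less than [b], gluing a local interval around it
   would prolong the intervals starting at [a] beyond it. The margin [e] is what makes consecutive
   intervals overlap. *)
pose A := [set x | a <= x <= b /\ exists2 e, 0 < e & P a (x + e)].
have Aa : A a.
  split; first by rewrite lexx ltW.
  by have [e e0 Pe] := Ploc a; exists e => //; apply: Pmono Pe; lra.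
have supA : has_sup A.
  by split; [exists a|exists b => x [/andP[]]].
have [e e0 Pe] := Ploc (sup A).
have [x [/andP[ax xb] [e' e'0 Pe']] xe] := sup_adherent e0 supA.
have xs : x <= sup A.
  by apply: ub_le_sup; [exact: supA.2|split; [rewrite ax|exists e']].
have sb : sup A <= b by apply: ge_sup; [exact: supA.1|move=> y [/andP[]]].
have Pse : P a (sup A + e).
  have [h|h] := leP (sup A + e) (x + e'); first exact: Pmono Pe'.
  have [h2|h2] := leP a (sup A - e); last by apply: Pmono Pe; lra.
  by apply: Pglue Pe' Pe; lra.
have [h|h] := leP b (sup A + e); first by apply: Pmono Pse; lra.
have : A (sup A + e / 2).
  by split; [apply/andP; split; lra|exists (e / 2); [lra|apply: Pmono Pse; lra]].
by move=> /(ub_le_sup supA.2); lra.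
Qed.

Section GlobalSide.
Context {R : realType}.
Variable L : set (plane R).
Hypothesis L_flat : locally_flat L.
Implicit Types (p q : plane R) (s : plane R -> bool).

Let L_closed : closed L. Proof. by case: L_flat. Qed.

Let good (a b c d : R) := exists s, forall q, rect a b c d q -> side_at L s q.

(** On the connected overlap [s1] and [s2] differ by a single bit [c], which is then absorbed into
    [s2]. *)
Lemma side_glue (W W1 W2 : set (plane R)) s1 s2 :
  open W1 -> open W2 -> connected (W1 `&` W2) -> W `<=` W1 `|` W2 ->
  (forall q, W1 q -> side_at L s1 q) -> (forall q, W2 q -> side_at L s2 q) ->
  exists s, forall q, W q -> side_at L s q.
Proof.
move=> oW1 oW2 cW WW h1 h2.
have [c hc] : exists c : bool, forall q, (W1 `&` W2) q -> ~ L q -> s1 q = s2 q (+) c.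
  apply: side_unique => //; first exact: openI.
    by move=> q [/h1].
  by move=> q [_ /h2].
exists (fun q => if `[< W1 q >] then s1 q else s2 q (+) c) => q /WW[Wq|Wq].
  apply: (side_at_near _ _ s1 false) => //; last exact: h1.
  have nW : nbhs q W1 by exact: open_nbhs_nbhs.
  by near=> r => _; rewrite asboolT ?addbF //; near: r.
apply: (side_at_near _ _ s2 c) => //; last exact: h2.
have nW : nbhs q W2 by exact: open_nbhs_nbhs.
near=> r => nLr; have W2r : W2 r by near: r.
by case: asboolP => // W1r; exact: hc.
Unshelve. all: by end_near. Qed.

Lemma rectI_connected (a b c d a' b' c' d' : R) :
  connected (rect a b c d `&` rect a' b' c' d').
Proof.
apply: plane_convex_connected => p q t [p1 p2] [q1 q2] t0 t1.
by split; exact: rect_convex.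
Qed.

(* Triviality of the Z/2-torsor of local sides, by gluing along overlapping
   rectangles, first vertically and then horizontally. *)
Lemma side_rect (a b c d : R) : a < b -> c < d -> good a b c d.
Proof.
move=> ab cd.
apply: (interval_gluing (fun a b => good a b c d)) ab => //.
- by move=> {}a {}b a' b' aa bb [s sP]; exists s => q [*]; apply: sP; split; lra.
- move=> x.
  (* The strip around the vertical line at [x] may get thinner at each gluing, so its half-width [e]
     is quantified existentially. *)
  apply: (interval_gluing (fun c d => exists2 e, 0 < e & good (x - e) (x + e) c d)) cd.
  + move=> {}c {}d c' d' cc dd [e e0 [s sP]]; exists e => //.
    by exists s => q [*]; apply: sP; split; lra.
  + move=> y; have [s [e [e0 sP]]] := side_local L L_flat (x, y).
    by exists e => //; exists e => //; exists s.
  + move=> {}c {}d c' d' cc cd dd [e e0 [s sP]] [e' e'0 [s' s'P]].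
    exists (Num.min e e'); first by rewrite lt_min e0.
    have [h1 h2] : Num.min e e' <= e /\ Num.min e e' <= e' by rewrite !ge_min !lexx orbT.
    apply: (side_glue _ _ _ s s' _ _ _ _ sP s'P); try exact: rect_open.
      exact: rectI_connected.
    move=> q [q1 q2 q3 q4]; have [h|h] := ltP q.2 d; [left|right]; split; lra.
- move=> {}a {}b a' b' aa ab bb [s sP] [s' s'P].
  apply: (side_glue _ _ _ s s' _ _ _ _ sP s'P); try exact: rect_open.
    exact: rectI_connected.
  move=> q [q1 q2 q3 q4]; have [h|h] := ltP q.1 b; [left|right]; split; lra.
Qed.

(** The plane is exhausted by the squares [W n] centred at a point [p0] off [L]. Side functions
    normalized to be true at [p0] agree on nested squares by [side_unique], so the value at [q] may
    be read in any square containing [q]; [N q] is the half-width of one. *)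
Theorem side_exists : exists s, forall q, side_at L s q.
Proof.
have [p0 _ nLp0] := flat_dense L L_flat (0, 0) setT filterT.
pose W (n : R) := rect (p0.1 - n) (p0.1 + n) (p0.2 - n) (p0.2 + n).
have Wp0 n : 0 < n -> W n p0 by exact: rect_center.
have Wle m n : m <= n -> W m `<=` W n.
  by move=> mn q [*]; split; lra.
have norm n : exists s, 0 < n -> (forall q, W n q -> side_at L s q) /\ s p0.
  have [n0|] := ltP 0 n; last by exists xpredT.
  have [s sP] : good (p0.1 - n) (p0.1 + n) (p0.2 - n) (p0.2 + n) by apply: side_rect; lra.
  (* Adding the bit [~~ s p0] makes the value at [p0] true. *)
  exists (fun q => s q (+) ~~ s p0) => _; split; last by case: (s p0).
  move=> q Wq; apply: (side_at_near _ _ s (~~ s p0)) => //; last exact: sP.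
  by near=> r.
have [s sP] := choice norm.
have agree m n q : 0 < m -> m <= n -> W m q -> ~ L q -> s m q = s n q.
  move=> m0 mn Wq nLq; have n0 : 0 < n by lra.
  have [c hc] : exists c : bool, forall q, W m q -> ~ L q -> s m q = s n q (+) c.
    apply: side_unique => //; first exact: rect_open.
    - exact/plane_convex_connected/rect_convex.
    - by move=> r Wr; apply: (sP _ _).1.
    - by move=> r Wr; apply: (sP _ _).1 => //; exact: Wle Wr.
  have := hc p0 (Wp0 _ m0) nLp0.
  rewrite (sP _ m0).2 (sP _ n0).2 (hc q Wq nLq).
  by case: (c) => // _; rewrite addbF.
pose N q : R := `|q.1 - p0.1| + `|q.2 - p0.2| + 1.
have N0 q : 0 < N q by rewrite ltr_wpDl // addr_ge0.
have WN q n : N q <= n -> W n q.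
  rewrite /N => h.
  have := ler_norm (q.1 - p0.1); have := ler_norm (q.2 - p0.2).
  have := ler_norm (- (q.1 - p0.1)); have := ler_norm (- (q.2 - p0.2)).
  rewrite !normrN => *.
  have := normr_ge0 (q.1 - p0.1); have := normr_ge0 (q.2 - p0.2) => *.
  by split; lra.
exists (fun q => s (N q) q) => q.
have nW : nbhs q (W (N q)).
  by apply: open_nbhs_nbhs; split; [exact: rect_open|exact: WN].
apply: (side_at_near _ _ (s (N q)) false) => //; last by apply: (sP _ _).1 => //; exact: WN.
near=> r => nLr; rewrite addbF.
have Wr : W (N q) r by near: r.
have [h|/ltW h] := leP (N q) (N r); first by rewrite (agree (N q) (N r)).
by apply: agree => //; exact: WN.
Unshelve. all: by end_near. Qed.

End GlobalSide.

(** * Proper lines and their ends *)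

Section ProperLines.
Context {R : realType}.
Implicit Types (l : R -> plane R) (L H K : set (plane R)) (e : set (set (plane R))).

Lemma plane_hausdorff : hausdorff_space (plane R).
Proof. exact: norm_hausdorff. Qed.

Lemma plane_compact_nbhs (p : plane R) : exists2 C, compact C & nbhs p C.
Proof.
exists (`[p.1 - 1, p.1 + 1]%classic `*` `[p.2 - 1, p.2 + 1]%classic).
  by apply: compact_setX; exact: segment_compact.
have := @open_nbhs_nbhs _ p (rect (p.1 - 1) (p.1 + 1) (p.2 - 1) (p.2 + 1)).
move=> /(_ (conj (rect_open _ _ _ _) (rect_center _ _ ltr01))).
apply: filterS => q [q1 q2 q3 q4].
by split; rewrite /= in_itv /=; apply/andP; split; exact: ltW.
Qed.

(** By properness only a compact piece of the line meets a compact neighbourhood of the limit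
    point. *)
Lemma proper_line_closed l (A : set R) : proper_line l -> closed A -> closed (l @` A).
Proof.
move=> [lc _ lproper] Acl q qA.
have [C Cc qC] := plane_compact_nbhs q.
have Bc : compact (l @` (A `&` l @^-1` C)).
  apply: continuous_compact; last by rewrite setIC; exact: compact_closedI (lproper _ Cc) Acl.
  by apply: continuous_subspaceT.
suff : (l @` (A `&` l @^-1` C)) q by move=> [t [At _] <-]; exists t.
apply: (compact_closed plane_hausdorff Bc) => N qN.
have [_ [[t At <-] [Nt Ct]]] := qA _ (filterI qN qC).
by exists (l t); split => //; exists t.
Qed.

Lemma proper_line_comp l (f g : R -> R) : continuous f -> continuous g ->
  cancel f g -> cancel g f -> proper_line l ->
  proper_line (l \o f) /\ range (l \o f) = range l.
Proof.
move=> fc gc fK gK [lc linj lproper]; split.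
  split.
  - by move=> t; apply: continuous_comp; [exact: fc|exact: lc].
  - by apply: inj_comp => //; exact: can_inj fK.
  - move=> C /lproper lC.
    have -> : (l \o f) @^-1` C = g @` (l @^-1` C).
      apply/seteqP; split => [t Ct|_ [t Ct <-]]; first by exists (f t).
      by rewrite /= gK.
    by apply: continuous_compact => //; exact: continuous_subspaceT.
apply/seteqP; split => [_ [t _ <-]|_ [t _ <-]]; first by exists (f t).
by exists (g t) => //=; rewrite gK.
Qed.

Lemma half_leaf_ge l (c : R) : proper_line l ->
  half_leaf (range l) (l @` [set t | c <= t]).
Proof.
move=> lp.
have [lp' lr] : proper_line (l \o (fun t => c + t)) /\ range (l \o (fun t => c + t)) = range l.
  apply: (proper_line_comp _ _ (fun t => - c + t)) => //.
  - by move=> t; apply: (@continuousD _ R R (fun=> c) id); [exact: cvg_cst|exact: cvg_id].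
  - by move=> t; apply: (@continuousD _ R R (fun=> - c) id); [exact: cvg_cst|exact: cvg_id].
  - by move=> t; lra.
  - by move=> t; lra.
exists (l \o (fun t => c + t)); split => //.
apply/seteqP; split => [_ [t /= ct <-]|_ [t /= t0 <-]].
  by exists (t - c); [rewrite /=; lra|rewrite /=; congr l; lra].
by exists (c + t) => //=; lra.
Qed.

Lemma half_leaf_le l (c : R) : proper_line l ->
  half_leaf (range l) (l @` [set t | t <= c]).
Proof.
move=> lp.
have [lp' lr] : proper_line (l \o -%R) /\ range (l \o -%R) = range l.
  by apply: (proper_line_comp _ _ -%R) => //; try exact: opprK; move=> t; exact: opp_continuous.
have := half_leaf_ge _ (- c) lp'; rewrite lr.
suff -> : (l \o -%R) @` [set t | - c <= t] = l @` [set t | t <= c] by [].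
apply/seteqP; split => [_ [t /= ct <-]|_ [t /= t0 <-]].
  by exists (- t) => //=; lra.
by exists (- t) => /=; [lra|rewrite opprK].
Qed.

Lemma half_leaf_sub L H : half_leaf L H -> H `<=` L.
Proof. by move=> [l [_ -> ->]] _ [t _ <-]; exists t. Qed.

Lemma half_leaf_nonempty L H : half_leaf L H -> H !=set0.
Proof. by move=> [l [_ _ ->]]; exists (l 0), 0 => /=. Qed.

Lemma range_connected l : continuous l -> connected (range l).
Proof.
move=> lc; apply: connected_continuous_connected.
  by apply/connected_intervalP => x y _ _ z _.
exact: continuous_subspaceT.
Qed.

Lemma half_leaf_connected L H : half_leaf L H -> connected H.
Proof.
move=> [l [[lc _ _] _ ->]]; apply: connected_continuous_connected.
  by apply/connected_intervalP => x y /= x0 y0 z /andP[xz _]; rewrite /=; lra.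
exact: continuous_subspaceT.
Qed.

Lemma half_leaf_unbounded L H (C : set (plane R)) : half_leaf L H -> compact C ->
  ~ H `<=` C.
Proof.
move=> [l [[_ _ lproper] _ ->]] /lproper lC HC.
have [M [_ /(_ (`|M| + 1))]] := compact_bounded lC.
have MM : M < `|M| + 1 by have := ler_norm M; lra.
move=> /(_ MM) /(_ (`|M| + 2)).
have := normr_ge0 M => M0.
have h : C (l (`|M| + 2)) by apply: HC; exists (`|M| + 2) => //=; lra.
by move=> /(_ h) /=; rewrite [`|_ + _|]ger0_norm => [?|]; lra.
Qed.

(** [K] comes with its own parametrization of the line, unrelated to [l]. Its connectedness makes
    its set of [l]-parameters convex, and its noncompactness makes that set unbounded above or
    below. *)
Lemma half_leaf_tail l K : proper_line l -> half_leaf (range l) K ->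
  (exists c, l @` [set t | c <= t] `<=` K) \/ (exists c, l @` [set t | t <= c] `<=` K).
Proof.
move=> lp hK; have [lc linj _] := lp.
(* If [K] missed [l d], the two closed rays of [l] issued from [l d] would disconnect it. *)
have between t1 d t2 : t1 < d -> d < t2 -> K (l t1) -> K (l t2) -> K (l d).
  move=> t1d dt2 K1 K2; apply: contrapT => nKd.
  pose f q := `[< (l @` [set t | t <= d]) q >].
  have f1 : f (l t1) by apply/asboolP; exists t1 => //=; exact: ltW.
  have f2 : f (l t2) = false.
    by apply/asboolP => -[t /= td /linj tt2]; rewrite tt2 in td; lra.
  suff : f (l t1) = f (l t2) by rewrite f1 f2.
  apply: (connected_locally_constant _ _ _ _ (half_leaf_connected _ _ hK)) => //.
  move=> q Kq; have [t _ tq] := half_leaf_sub _ _ hK q Kq.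
  have [td|dt] := leP t d.
    have nq : ~ (l @` [set t | d <= t]) q.
      move=> [t' /= dt' t'q]; have tt' : t' = t by apply: linj; rewrite t'q.
      by apply: nKd; rewrite (_ : d = t) ?tq //; lra.
    have : \forall q' \near q, ~ (l @` [set t | d <= t]) q'.
      apply: open_nbhs_nbhs; split => //; apply: closed_openC.
      by apply: proper_line_closed => //; exact: closed_ge.
    apply: filterS => q' nq' Kq'.
    have [t' _ t'q'] := half_leaf_sub _ _ hK q' Kq'.
    rewrite /f !asboolT //; first by exists t.
    exists t' => //=; rewrite leNgt; apply/negP => dt'.
    by apply: nq'; exists t' => //=; exact: ltW.
  have nq : ~ (l @` [set t | t <= d]) q.
    by move=> [t' /= dt' t'q]; have tt' : t' = t by [apply: linj; rewrite t'q]; lra.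
  have : \forall q' \near q, ~ (l @` [set t | t <= d]) q'.
    apply: open_nbhs_nbhs; split => //; apply: closed_openC.
    by apply: proper_line_closed => //; exact: closed_le.
  by apply: filterS => q' nq' Kq'; rewrite /f !asboolF.
have [up|/existsNP[M Mup]] := pselect (forall M, exists2 t, M < t & K (l t)).
  left; have [t0 _ Kt0] := up 0; exists t0 => _ [t /= t0t <-].
  have [t2 tt2 Kt2] := up t.
  move: t0t; rewrite le_eqVlt => /predU1P[<-//|t0t].
  exact: between t0t tt2 Kt0 Kt2.
have [dn|/existsNP[m mdn]] := pselect (forall M, exists2 t, t < M & K (l t)).
  right; have [t0 _ Kt0] := dn 0; exists t0 => _ [t /= t0t <-].
  have [t2 tt2 Kt2] := dn t.
  move: t0t; rewrite le_eqVlt => /predU1P[->//|t0t].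
  exact: between tt2 t0t Kt2 Kt0.
(* Otherwise [K] lies in the compact arc of [l] over the segment from [m] to [M]. *)
exfalso.
have Cc : compact (l @` `[m, M]%classic).
  by apply: continuous_compact; [exact: continuous_subspaceT|exact: segment_compact].
apply: (half_leaf_unbounded _ _ _ hK Cc) => q Kq.
have [t _ tq] := half_leaf_sub _ _ hK q Kq; exists t => //=.
rewrite in_itv /=; apply/andP; split; rewrite leNgt; apply/negP => h.
  by apply: mdn; exists t; rewrite ?tq.
by apply: Mup; exists t; rewrite ?tq.
Qed.

Lemma half_leaf_ray_tail l K : proper_line l -> half_leaf (range l) K ->
  K `<=` l @` [set t | 0 <= t] -> exists c, l @` [set t | c <= t] `<=` K.
Proof.
move=> lp hK Kl; have [//|[c cK]] := half_leaf_tail _ _ lp hK.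
have [_ linj _] := lp.
have : K (l (Num.min c 0 - 1)).
  have mc : Num.min c 0 <= c by rewrite ge_min lexx.
  by apply: cK; exists (Num.min c 0 - 1) => //=; lra.
move=> /Kl[t /= t0 /linj h].
have : Num.min c 0 <= 0 by rewrite ge_min lexx orbT.
lra.
Qed.

Lemma same_germ_sym L H K : same_germ L H K -> same_germ L K H.
Proof. by move=> [M hM MHK]; exists M => // q /MHK[]. Qed.

Lemma same_germ_refl L H : half_leaf L H -> same_germ L H H.
Proof. by move=> hH; exists H. Qed.

(** Both witnesses lie in [H2], which is a ray, and each contains a tail of it; the shorter of the
    two tails is common to all. *)
Lemma same_germ_trans L H1 H2 H3 : half_leaf L H2 ->
  same_germ L H1 H2 -> same_germ L H2 H3 -> same_germ L H1 H3.
Proof.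
move=> [l [lp -> ->]] [K hK KH] [K' hK' K'H].
have [c cK] : exists c, l @` [set t | c <= t] `<=` K.
  by apply: half_leaf_ray_tail => // q /KH[].
have [c' cK'] : exists c, l @` [set t | c <= t] `<=` K'.
  by apply: half_leaf_ray_tail => // q /K'H[].
exists (l @` [set t | Num.max c c' <= t]); first exact: half_leaf_ge.
move=> _ [t /= + <-]; rewrite ge_max => /andP[ct c't]; split.
  by have /KH[] : K (l t) by apply: cK; exists t.
by have /K'H[] : K' (l t) by apply: cK'; exists t.
Qed.

Lemma leaf_end_eq L e1 e2 K1 K2 : leaf_end L e1 -> leaf_end L e2 ->
  e1 K1 -> e2 K2 -> same_germ L K1 K2 -> e1 = e2.
Proof.
move=> [H1 h1 ->] [H2 h2 ->] [k1 g1] [k2 g2] g12.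
have g : same_germ L H1 H2.
  apply: (same_germ_trans _ _ _ _ k1 g1).
  by apply: (same_germ_trans _ _ _ _ k2 g12); exact: same_germ_sym.
apply/seteqP; split => K [hK gK]; split => //.
  by apply: (same_germ_trans _ _ _ _ h1) => //; exact: same_germ_sym.
exact: (same_germ_trans _ _ _ _ h2 g gK).
Qed.

(** Parametrize [L] so that [K1] is the ray of nonnegative parameters. As the ends differ, [K2]
    contains a tail at the other infinity, and what remains is a compact arc. *)
Lemma leaf_end_cover L e1 e2 K1 K2 : leaf_end L e1 -> leaf_end L e2 -> e1 <> e2 ->
  e1 K1 -> e2 K2 -> exists2 C, compact C & L `<=` C `|` K1 `|` K2.
Proof.
move=> h1 h2 e12 e1K1 e2K2.
have [l [lp Ll K1l]] : half_leaf L K1 by case: h1 e1K1 => H _ -> [].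
have hK2 : half_leaf (range l) K2 by rewrite -Ll; case: h2 e2K2 => H _ -> [].
have [[c cK]|[c cK]] := half_leaf_tail _ _ lp hK2.
  exfalso; apply: e12; apply: (leaf_end_eq _ _ _ _ _ h1 h2 e1K1 e2K2).
  exists (l @` [set t | Num.max c 0 <= t]); first by rewrite Ll; exact: half_leaf_ge.
  move=> _ [t /= + <-]; rewrite ge_max => /andP[ct t0]; split.
    by rewrite K1l; exists t.
  by apply: cK; exists t.
exists (l @` `[c, 0]%classic).
  apply: continuous_compact; last exact: segment_compact.
  by case: lp => lc _ _; exact: continuous_subspaceT.
rewrite Ll => _ [t _ <-].
have [t0|t0] := leP 0 t; first by left; right; rewrite K1l; exists t.
have [tc|tc] := leP t c; first by right; apply: cK; exists t.
by left; left; exists t => //=; rewrite in_itv /= !ltW.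
Qed.

Lemma half_leaf_end L H : half_leaf L H ->
  leaf_end L [set K | half_leaf L K /\ same_germ L H K].
Proof. by move=> hH; exists H. Qed.

(** The two rays issued from [l 0] share only that point, which contains no half leaf. *)
Lemma two_leaf_ends l : proper_line l -> exists e1 e2,
  [/\ leaf_end (range l) e1, leaf_end (range l) e2 & e1 <> e2].
Proof.
move=> lp; have hg := half_leaf_ge _ 0 lp; have hl := half_leaf_le _ 0 lp.
do 2 eexists; split; [exact: half_leaf_end hg|exact: half_leaf_end hl|].
move=> /seteqP[/(_ _ (conj hg (same_germ_refl _ _ hg)))] [_ [K hK KK] _].
apply: (half_leaf_unbounded _ _ [set l 0] hK); first exact: compact_set1.
move=> q /KK[[t /= t0 <-] [t' /= t'0]].
have [_ linj _] := lp.
move=> /linj tt'; rewrite (_ : t = 0) //; move: t0 t'0 => /=; lra.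
Qed.

Lemma leaf_end_half_leaf L e K : leaf_end L e -> e K -> half_leaf L K.
Proof. by move=> [H _ ->] []. Qed.

Lemma leaf_end_nonempty L e : leaf_end L e -> e !=set0.
Proof. by move=> [H hH ->]; exists H; split => //; exact: same_germ_refl. Qed.

End ProperLines.

(** * Charts, transversals and leaves *)

Section Foliation.
Context {R : realType}.
Variable F : set (set (plane R)).
Hypothesis F_foliation : foliation F.
Implicit Types (p q : plane R) (L U : set (plane R)) (h g : plane R -> plane R).

Lemma leaf_through p : exists2 L, F L & L p.
Proof.
case: F_foliation => -[Fcover _ _] _ _.
have : cover F id p by rewrite Fcover.
by move=> [L FL Lp]; exists L.
Qed.

Lemma leaf_unique L L' p : F L -> F L' -> L p -> L' p -> L = L'.
Proof.
case: F_foliation => -[_ Ftriv _] _ _ FL FL' Lp L'p.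
by apply: Ftriv => //; exists p.
Qed.

Lemma leaf_line L : F L -> exists2 l, proper_line l & L = range l.
Proof. by case: F_foliation => _ + _; apply. Qed.

Lemma leaf_closed L : F L -> closed L.
Proof.
by move=> /leaf_line[l lp ->]; apply: proper_line_closed => //; exact: closedT.
Qed.

Lemma leaf_connected L : F L -> connected L.
Proof. by move=> /leaf_line[l [lc _ _] ->]; exact: range_connected. Qed.

(** The coordinates fill the whole plane, so [g] is total and each vertical line [u |-> g (a, u)] is
    a transversal parametrized by all of [R]. *)
Definition chart U h g : Prop :=
  [/\ open U, forall q, U q -> {for q, continuous h}, continuous g,
      straightens F U h snd &
      [/\ forall q, U (g q), forall q, U q -> g (h q) = q & cancel g h]].

Lemma chart_exists p : exists U h g, chart U h g /\ U p.
Proof.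
case: F_foliation => _ _ /(_ p)[U [h [oU Up [g [hc gc _ gU [gh hg]]] hs]]].
exists U, h, g; split => //; split => //.
- move=> q Uq; move: hc; rewrite continuous_open_subspace // => hc.
  by apply: hc; rewrite inE.
- by apply/continuous_subspace_setT.
- split.
  + by move=> q; exact: gU.
  + by move=> q Uq; apply: gh; rewrite inE.
  + by move=> q; apply: hg; rewrite inE.
Qed.

Section Chart.
Variables (U : set (plane R)) (h g : plane R -> plane R).
Hypothesis Uhg : chart U h g.

Lemma chart_plaque L q q' : F L -> L q -> U q -> U q' -> (h q').2 = (h q).2 -> L q'.
Proof.
move=> FL Lq Uq Uq' hqq'; case: Uhg => _ _ _ hs _.
have /seteqP[_ /(_ q' (conj Uq' hqq'))] := hs L FL q (conj Lq Uq).
by move=> /(@connected_component_sub _ _ _)[].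
Qed.

(** A leaf does not accumulate on itself: a short arc of [L] through [p] stays in one plaque, and
    the rest of [L] is closed by properness and misses [p]. *)
Lemma chart_isolated L p : F L -> L p -> U p ->
  \forall q \near p, L q -> (h q).2 = (h p).2.
Proof.
move=> FL Lp Up; case: Uhg => oU _ _ hs _.
have [l lp Ll] := leaf_line _ FL; have [lc linj _] := lp.
move: (Lp); rewrite Ll => -[t0 _ lt0].
have /nbhs_ballP[e /= e0 eU] : nbhs t0 (l @^-1` U).
  by apply: lc; rewrite lt0; exact: open_nbhs_nbhs.
have : \forall q \near p, ~ (l @` (~` ball t0 e)) q.
  apply: open_nbhs_nbhs; split.
    apply/closed_openC/proper_line_closed => //; apply: open_closedC.
    exact: ball_open.
  move=> [t nt]; rewrite -lt0 => /linj tt0; apply: nt; rewrite tt0.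
  exact: ballxx.
apply: filterS => q nq [t _ tq].
have te : ball t0 e t by apply: contrapT => nt; apply: nq; exists t.
have /seteqP[+ _] := hs L FL p (conj Lp Up).
move=> /(_ q)[] //; exists (l @` ball t0 e); last by exists t.
split.
- by exists t0 => //; exact: ballxx.
- by move=> _ [t' te' <-]; split; [rewrite Ll; exists t'|exact: eU].
- apply: connected_continuous_connected; last exact: continuous_subspaceT.
  by rewrite ball_itv; apply/connected_intervalP; exact: interval_is_interval.
Qed.

Lemma chart_open (O : set (plane R)) : open O -> open (g @` O).
Proof.
case: Uhg => oU hc _ _ [gU gh hg] oO.
rewrite openE => _ [q Oq <-]; rewrite /interior.
have : \forall r \near g q, O (h r).
  by apply: hc => //; rewrite hg; exact: open_nbhs_nbhs.
have : nbhs (g q) U by exact: open_nbhs_nbhs.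
by apply: filterS2 => r Ur Or; exists (h r) => //; exact: gh.
Qed.

Lemma chart_box L p N : F L -> L p -> U p -> nbhs p N ->
  exists2 e : R, 0 < e & forall z,
    rect ((h p).1 - e) ((h p).1 + e) ((h p).2 - e) ((h p).2 + e) z ->
    N (g z) /\ (L (g z) <-> z.2 = (h p).2).
Proof.
move=> FL Lp Up Np; case: Uhg => _ _ gc _ [gU gh hg].
have : nbhs (h p) (g @^-1` (N `&` [set q | L q -> (h q).2 = (h p).2])).
  by apply: gc; rewrite gh //; apply: filterI => //; exact: chart_isolated.
move=> /rect_nbhs[e e0 eN]; exists e => // z /eN[Nz Lz]; split => //; split.
  by move=> /Lz; rewrite hg.
by move=> zp; apply: (chart_plaque _ p) => //; rewrite hg.
Qed.

Lemma chart_flat_box L p N (x := (h p).1) (y := (h p).2) :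
  F L -> L p -> U p -> nbhs p N ->
  exists2 e : R, 0 < e & let B1 := g @` rect (x - e) (x + e) y (y + e) in
    let B2 := g @` rect (x - e) (x + e) (y - e) y in
    [/\ flat_box L p (g @` rect (x - e) (x + e) (y - e) (y + e)) B1 B2,
        B1 `<=` N & B2 `<=` N].
Proof.
move=> FL Lp Up Np; have [e e0 eP] := chart_box _ _ _ FL Lp Up Np.
case: Uhg => _ _ gc _ [gU gh hg].
have gB a b c d : open (g @` rect a b c d) /\ connected (g @` rect a b c d).
  split; first by apply: chart_open; exact: rect_open.
  apply: connected_continuous_connected; last exact: continuous_subspaceT.
  exact/plane_convex_connected/rect_convex.
have up z : rect (x - e) (x + e) y (y + e) z -> rect (x - e) (x + e) (y - e) (y + e) z.
  by move=> [*]; split; lra.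
have dn z : rect (x - e) (x + e) (y - e) y z -> rect (x - e) (x + e) (y - e) (y + e) z.
  by move=> [*]; split; lra.
exists e => //=; split.
- split.
  + split; first exact: (gB _ _ _ _).1.
      by exists (h p); [exact: rect_center|exact: gh].
    move=> _ [z zr <-]; have [zy|yz|zy] := ltgtP z.2 y.
    * by left; right; exists z => //; case: zr.
    * by left; left; exists z => //; case: zr.
    * by right; exact: (eP z zr).2.2.
  + split; [exact: (gB _ _ _ _).1|exact: (gB _ _ _ _).2|].
    apply/seteqP; split => // _ [[z zr <-]] /(eP z (up z zr)).2.1 zy.
    by case: zr => _ _; rewrite zy ltxx.
  + split; [exact: (gB _ _ _ _).1|exact: (gB _ _ _ _).2|].
    apply/seteqP; split => // _ [[z zr <-]] /(eP z (dn z zr)).2.1 zy.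
    by case: zr => _ _ _; rewrite zy ltxx.
  + apply/seteqP; split => // _ [[z zr <-]] [z' zr' /(can_inj hg) zz'].
    by case: zr zr' => _ _ + _ [_ _ _]; rewrite zz'; lra.
  + move=> _ [[z zr <-]] /(eP z zr).2.1 zy.
    have cl (b : bool) M : nbhs (g z) M -> exists z', [/\ M (g z'), x - e < z'.1 < x + e,
        `|z'.2 - y| < e & if b then y < z'.2 else z'.2 < y].
      move=> /(gc z) /rect_nbhs[d d0 dM].
      have [m0 md me] : [/\ 0 < Num.min d e, Num.min d e <= d & Num.min d e <= e].
        by rewrite lt_min d0 e0 !ge_min !lexx orbT.
      case: zr => z1 z2 _ _; rewrite -/y in zy.
      (* The point is pushed vertically off the leaf: [d] keeps it in [M] and [e] keeps it in the
         box. *)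
      exists (z.1, y + (if b then 1 else -1) * (Num.min d e / 2)); split.
      - by apply: dM; rewrite zy; split => /=; case: (b); lra.
      - by apply/andP; split.
      - by rewrite /= [X in X - y]addrC addrK; case: (b);
          rewrite ?mul1r ?mulN1r ?normrN gtr0_norm; lra.
      - by case: (b) => /=; lra.
    split => M /cl cM.
      have [z' [Mz' /andP[z'1 z'2] + yz']] := cM true; rewrite ltr_distl => /andP[_ z'3].
      by exists (g z'); split => //; exists z'.
    have [z' [Mz' /andP[z'1 z'2] + yz']] := cM false; rewrite ltr_distl => /andP[z'3 _].
    by exists (g z'); split => //; exists z'.
- by move=> _ [z /up/eP[Nz _] <-].
- by move=> _ [z /dn/eP[Nz _] <-].
Qed.

End Chart.

Lemma leaf_flat L : F L -> locally_flat L.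
Proof.
move=> FL; split; first exact: leaf_closed.
move=> p Lp N Np; have [U [h [g [Uhg Up]]]] := chart_exists p.
have [e _ [fb h1 h2]] := chart_flat_box _ _ _ Uhg _ _ _ FL Lp Up Np.
by do 3 eexists; split; [exact: fb|exact: h1|exact: h2].
Qed.

Definition side L s := forall q, side_at L s q.

Lemma leaf_side L : F L -> exists s, side L s.
Proof. by move=> /leaf_flat/side_exists. Qed.

Lemma side_connected L s A p q : side L s -> connected A -> A `&` L = set0 ->
  A p -> A q -> s p = s q.
Proof.
move=> sL cA AL; apply: (side_at_connected L) => // r Ar; split => // Lr.
by have : (A `&` L) r by []; rewrite AL.
Qed.

Lemma leaves_disjoint L L' : F L -> F L' -> L <> L' -> L `&` L' = set0.
Proof.
move=> FL FL' LL'; apply/seteqP; split => // p [Lp L'p].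
by apply: LL'; exact: leaf_unique Lp L'p.
Qed.

Lemma side_leaf L L' s p q : side L s -> F L -> F L' -> L' <> L -> L' p -> L' q -> s p = s q.
Proof.
move=> sL FL FL' L'L; apply: side_connected sL (leaf_connected _ FL') _.
exact: leaves_disjoint.
Qed.

Section Transversal.
Variables (U : set (plane R)) (h g : plane R -> plane R) (a : R).
Hypothesis Uhg : chart U h g.
Let tau (u : R) := g (a, u).

Lemma transversal_connected (J : set R) : is_interval J -> connected (tau @` J).
Proof.
move=> iJ; apply: connected_continuous_connected; first exact/connected_intervalP.
apply: continuous_subspaceT => t; case: Uhg => _ _ gc _ _.
apply: (@continuous_comp _ _ _ (fun u => (a, u)) g); last exact: gc.
by apply: (continuous_pairing _ (fun=> a) id) => u; [exact: cvg_cst|exact: cvg_id].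
Qed.

Lemma transversal_isolated L u : F L -> L (tau u) ->
  exists2 e : R, 0 < e & forall v, `|v - u| < e -> L (tau v) -> v = u.
Proof.
move=> FL Lu; case: (Uhg) => _ _ _ _ [gU gh hg].
have [e e0 eP] := chart_box _ _ _ Uhg _ _ setT FL Lu (gU _) filterT.
exists e => // v; rewrite ltr_distl => /andP[v1 v2].
have [] := eP (a, v); first by rewrite hg /=; split => /=; lra.
by rewrite hg /= => _ [+ _].
Qed.

(** The value of [s] jumps inside a flat box at [tau u] and is constant on the two subarcs on either
    side of [u], since these miss [L]. The points at [u - d1 / 2] and [u + d2 / 2] lie both in the
    box and on these arcs. *)
Lemma side_crossing L s u u1 u2 : F L -> side L s -> L (tau u) ->
  u1 < u -> u < u2 -> (forall v, u1 <= v -> v <= u2 -> L (tau v) -> v = u) ->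
  s (tau u1) <> s (tau u2).
Proof.
move=> FL sL Lu u1u uu2 Lonly; case: (Uhg) => _ _ _ _ [gU gh hg].
have [e e0 [fb _ _]] := chart_flat_box _ _ _ Uhg _ _ setT FL Lu (gU _) filterT.
have [c []] := flat_box_sides _ _ _ _ _ _ Lu fb (fun q _ => sL q).
rewrite hg /= => c1 c2.
pose d1 := Num.min e (u - u1); pose d2 := Num.min e (u2 - u).
have [d10 d1e d1u] : [/\ 0 < d1, d1 <= e & d1 <= u - u1].
  by rewrite lt_min e0 subr_gt0 u1u !ge_min !lexx orbT.
have [d20 d2e d2u] : [/\ 0 < d2, d2 <= e & d2 <= u2 - u].
  by rewrite lt_min e0 subr_gt0 uu2 !ge_min !lexx orbT.
have s2 : s (tau (u + d2 / 2)) = c.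
  by apply: c1; exists (a, u + d2 / 2) => //; split => /=; lra.
have s1 : s (tau (u - d1 / 2)) = ~~ c.
  by apply: c2; exists (a, u - d1 / 2) => //; split => /=; lra.
have sconst (J : set R) v w : is_interval J -> (forall r, J r -> u1 <= r <= u2 /\ r != u) ->
    J v -> J w -> s (tau v) = s (tau w).
  move=> iJ JP Jv Jw; apply: (side_connected _ _ _ _ _ sL (transversal_connected _ iJ)).
  - apply/seteqP; split => // _ [[r Jr <-] Lr].
    by have [/andP[r1 r2]] := JP r Jr; rewrite (Lonly r r1 r2 Lr) eqxx.
  - by exists v.
  - by exists w.
have -> : s (tau u1) = ~~ c.
  rewrite -s1; apply: (sconst [set r | u1 <= r < u]) => /=.
  - by move=> v w /= /andP[v1 v2] /andP[w1 w2] r /andP[vr rw]; apply/andP; split; lra.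
  - by move=> r /andP[r1 r2]; split; [apply/andP; split; lra|rewrite lt_eqF].
  - by apply/andP; split; lra.
  - by apply/andP; split; lra.
have -> : s (tau u2) = c.
  rewrite -s2; apply: (sconst [set r | u < r <= u2]) => /=.
  - by move=> v w /= /andP[v1 v2] /andP[w1 w2] r /andP[vr rw]; apply/andP; split; lra.
  - by move=> r /andP[r1 r2]; split; [apply/andP; split; lra|rewrite gt_eqF].
  - by apply/andP; split; lra.
  - by apply/andP; split; lra.
by case: (c).
Qed.

(** [L'] lies on one side of [L], so the arc between two of its points cannot cross [L] exactly
    once. *)
Lemma crossing_again L L' u v w : F L -> F L' -> L' <> L ->
  u < v -> v < w -> L' (tau u) -> L' (tau w) -> L (tau v) ->
  exists r, [/\ u <= r, r <= w, r != v & L (tau r)].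
Proof.
move=> FL FL' L'L uv vw L'u L'w Lv; apply: contrapT => nr.
have [s sL] := leaf_side _ FL.
apply: (side_crossing _ _ _ _ _ FL sL Lv uv vw).
  move=> r ur rw Lr; apply/eqP; apply: contrapT => /negP rv.
  by apply: nr; exists r.
exact: side_leaf sL FL FL' L'L L'u L'w.
Qed.

Let returns (z : R * R) := z.1 < z.2 /\
  exists L, [/\ F L, L (tau z.1) & L (tau z.2)].

(** The leaf through the midpoint [m] either is [L], or meets the arc a second time by
    [crossing_again]. In both cases [m] is an endpoint of a returning pair contained in one half. *)
Lemma returns_bisect z : returns z ->
  exists z', [/\ returns z', z.1 <= z'.1, z'.2 <= z.2 & z'.2 - z'.1 <= (z.2 - z.1) / 2].
Proof.
case: z => u w [/= uw [L [FL Lu Lw]]].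
pose m := (u + w) / 2; have [um mw] : u < m /\ m < w by rewrite /m; split; lra.
have [L' FL' L'm] := leaf_through (tau m).
have [LL'|LL'] := pselect (L = L').
  exists (u, m); split => /=; [|lra|lra|rewrite /m; lra].
  by split => //; exists L; split => //=; rewrite LL'.
have [r [ur rw rm L'r]] := crossing_again _ _ _ _ _ FL' FL LL' um mw Lu Lw L'm.
have [rlm|mlr|/eqP] := ltgtP r m; last by rewrite (negbTE rm).
  by exists (r, m); split => /=; [split => //; exists L'|lra|lra|rewrite /m; lra].
by exists (m, r); split => /=; [split => //; exists L'|lra|lra|rewrite /m; lra].
Qed.

(* If a leaf returned to the transversal, bisection would produce pairs of
   parameters on a common leaf shrinking to some x; then the leaf of x itself
   returns arbitrarily close to x, contradicting [transversal_isolated]. *)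
Lemma transversal_lt L u v : F L -> L (tau u) -> L (tau v) -> ~ u < v.
Proof.
move=> FL Lu Lv uv.
have Ruv : returns (u, v) by split => //; exists L.
have step_ex z : exists z', returns z ->
    [/\ returns z', z.1 <= z'.1, z'.2 <= z.2 & z'.2 - z'.1 <= (z.2 - z.1) / 2].
  have [/returns_bisect[z' z'P]|nz] := pselect (returns z); last by exists z.
  by exists z'.
have [step stepP] := choice step_ex.
pose z n := iter n step (u, v).
have zR n : returns (z n) by elim: n => [//|n /stepP[]].
have zlen n : (z n).2 - (z n).1 <= (v - u) / 2 ^+ n.
  elim: n => [|n IH]; first by rewrite expr0 divr1.
  have [_ _ _] := stepP _ (zR n).
  have -> : (v - u) / 2 ^+ n.+1 = (v - u) / 2 ^+ n / 2 by rewrite exprSr invfM mulrA.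
  by rewrite -[step (z n)]/(z n.+1); lra.
have zmono m n : (m <= n)%N -> (z m).1 <= (z n).1 /\ (z n).2 <= (z m).2.
  move=> /subnK <-; elim: (n - m)%N => [//|k [IH1 IH2]].
  have [_ h1 h2 _] := stepP _ (zR (k + m)%N).
  by rewrite addSn -[z (k + m).+1]/(step (z (k + m)%N)); split; lra.
have zle m n : (z m).1 <= (z n).2.
  have [mn|/ltnW nm] := leqP m n.
    by have [z1 _] := zmono _ _ mn; have [z2 _] := zR n; lra.
  by have [_ z1] := zmono _ _ nm; have [z2 _] := zR m; lra.
pose A := range (fun n => (z n).1).
have supA : has_sup A.
  by split; [exists (z 0%N).1, 0%N|exists (z 0%N).2 => _ [n _ <-]].
pose x := sup A.
have xge n : (z n).1 <= x by apply: ub_le_sup; [exact: supA.2|exists n].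
have xle n : x <= (z n).2 by apply: ge_sup; [exact: supA.1|move=> _ [m _ <-]].
have [L' FL' L'x] := leaf_through (tau x).
have [e e0 eP] := transversal_isolated _ _ FL' L'x.
have [n nP] : exists n, (z n).2 - (z n).1 < e.
  have : \forall n \near \oo, (v - u) / 2 ^+ n < e.
    have d0 : 0 < e / (v - u) by rewrite divr_gt0 // subr_gt0.
    have := near_infty_natSinv_expn_lt (PosNum d0).
    apply: filterS => n /=; rewrite div1r ltr_pdivlMr ?subr_gt0 // mulrC.
    by [].
  by move=> [n _ /(_ n (leqnn n)) ne]; exists n; exact: le_lt_trans (zlen n) ne.
have [zn [L'' [FL'' L1 L2]]] := zR n.
have near_x r : (z n).1 <= r -> r <= (z n).2 -> L' (tau r) -> r = x.
  move=> r1 r2; apply: eP; have := xge n; have := xle n.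
  by rewrite ltr_distl => *; apply/andP; split; lra.
have [LL|LL] := pselect (L'' = L').
  rewrite LL in L1 L2.
  have := near_x _ (lexx _) (ltW zn) L1; have := near_x _ (ltW zn) (lexx _) L2.
  by move=> z1 z2; move: zn; rewrite z1 z2 ltxx.
have neq r : L'' (tau r) -> r != x.
  by move=> Lr; apply/eqP => rx; apply: LL; apply: leaf_unique L'x => //; rewrite -rx.
have x1 : (z n).1 < x by rewrite lt_neqAle neq // xge.
have x2 : x < (z n).2 by rewrite lt_neqAle xle andbT eq_sym neq //.
have [r [r1 r2 + L'r]] := crossing_again _ _ _ _ _ FL' FL'' LL x1 x2 L1 L2 L'x.
by rewrite (near_x r) ?eqxx.
Qed.

Lemma transversal_injective L u v : F L -> L (tau u) -> L (tau v) -> u = v.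
Proof.
move=> FL Lu Lv; have [uv|vu|//] := ltgtP u v.
  by case: (transversal_lt _ _ _ FL Lu Lv uv).
by case: (transversal_lt _ _ _ FL Lv Lu vu).
Qed.

Lemma transversal_sides L s u u1 u2 : F L -> side L s -> L (tau u) ->
  u1 < u -> u < u2 -> s (tau u1) <> s (tau u2).
Proof.
move=> FL sL Lu u1u uu2; apply: (side_crossing L s u) => // v _ _ Lv.
exact: transversal_injective FL Lv Lu.
Qed.

End Transversal.

End Foliation.

(** * Leaves near a regular leaf *)

Section Regular.
Context {R : realType}.
Variable F : set (set (plane R)).
Hypothesis F_foliation : foliation F.
Implicit Types (p q : plane R) (L E : set (plane R)).

(** Sliding along plaques in a chart carries points of [E] near [r] to points of [E] near [r'].
    Hence membership in the closure is locally constant along each leaf, and leaves are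
    connected. *)
Lemma closure_saturated E : saturated F E -> saturated F (closure E).
Proof.
move=> Esat L FL [p [Lp Ep]] q Lq.
have plaque U h g r r' : chart F U h g -> U r -> U r' -> (h r').2 = (h r).2 ->
    closure E r -> closure E r'.
  move=> Uhg Ur Ur' rr' Er M Mr'; case: (Uhg) => oU hc gc _ [gU gh hg].
  (* [k] keeps the height of [z], hence its leaf, and moves it to the vertical line of [r']. *)
  pose k z := g ((h r').1, (h z).2).
  have kr : k r = r' by rewrite /k -rr' -surjective_pairing gh.
  have kc : {for r, continuous k}.
    apply: (@continuous_comp _ _ _ h (fun w : plane R => g ((h r').1, w.2))); first exact: hc.
    apply: (@continuous_comp _ _ _ snd (fun u => g ((h r').1, u))); first exact: cvg_snd.
    apply: (@continuous_comp _ _ _ (fun u => ((h r').1, u)) g); last exact: gc.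
    by apply: (continuous_pairing _ (fun=> (h r').1) id) => u; [exact: cvg_cst|exact: cvg_id].
  have kM : nbhs r (k @^-1` M) by apply: kc; rewrite kr.
  have nU : nbhs r U by exact: open_nbhs_nbhs.
  have [z [Ez [Mz Uz]]] := Er _ (filterI kM nU).
  exists (k z); split => //.
  have [L' FL' L'z] := leaf_through _ F_foliation z.
  apply: (Esat L') => //; first by exists z.
  by apply: (chart_plaque _ _ _ _ Uhg _ z) => //; rewrite /k ?hg.
apply/asboolP.
have -> : `[< closure E q >] = `[< closure E p >].
  apply: (connected_locally_constant _ _ _ (fun r => `[< closure E r >])
            (leaf_connected _ F_foliation _ FL)) => // r Lr.
  have [U [h [g [Uhg Ur]]]] := chart_exists _ F_foliation r.
  have nU : nbhs r U by case: Uhg => oU _ _ _ _; exact: open_nbhs_nbhs.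
  have := chart_isolated _ F_foliation _ _ _ Uhg _ _ FL Lr Ur.
  apply: filterS2 nU => r' Ur' + Lr' => /(_ Lr') rr'.
  by apply: asbool_equiv_eq; split; apply: plaque Uhg _ _ _.
exact/asboolP.
Qed.

(** Near [b], [tau] stays in a saturated neighbourhood of [L1] disjoint from one of [L']; by
    saturation, so do the entire leaves met there. *)
Lemma regular_avoid L1 L' (tau : R -> plane R) (b : R) :
  regular_leaf F L1 -> F L' -> L' <> L1 -> {for b, continuous tau} -> L1 (tau b) ->
  exists2 M, set_nbhs L' M & exists2 e : R, 0 < e & forall u L,
    `|u - b| < e -> F L -> L (tau u) -> L `&` M = set0.
Proof.
move=> [FL1 L1reg] FL' L'L1 tauc L1b.
have [M1 [M [nM1 nM sM1 _ M1M]]] := L1reg L' FL' L'L1.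
exists M => //.
have /nbhs_ballP[e /= e0 eM] : nbhs b (tau @^-1` M1) by apply: tauc; exact: nM1.
exists e => // u L ue FL Lu.
have LM1 : L `<=` M1.
  by apply: sM1 => //; exists (tau u); split => //; apply: eM; rewrite /ball /= distrC.
by apply/seteqP; split => // q [/LM1 M1q Mq]; rewrite -M1M.
Qed.

(* The set E of the points separated from [p1] neither by all leaves slightly
   above L1 nor by all leaves slightly below L1 is open by regularity and
   saturated. Its closure avoids [p1], hence all of L1, so that E is also closed;
   therefore E is empty. *)
Lemma regular_separates L1 L2 U h g (p1 p2 : plane R) :
  regular_leaf F L1 -> F L2 -> L2 <> L1 -> chart F U h g -> U p1 -> L1 p1 -> L2 p2 ->
  exists c d : R, c < d /\ forall u L, c < u -> u < d ->
    F L -> L (g ((h p1).1, u)) ->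
    [/\ L <> L1, L <> L2 & forall s, side L s -> s p1 <> s p2].
Proof.
move=> L1reg FL2 L21 Uhg Up1 L1p1 L2p2; case: (Uhg) => oU hc gc _ [gU gh hg].
have FL1 := L1reg.1.
set a := (h p1).1; pose b := (h p1).2; pose tau u := g (a, u).
have taub : tau b = p1 by rewrite /tau /a /b -surjective_pairing gh.
have tauc : {for b, continuous tau}.
  apply: (@continuous_comp _ _ _ (fun u => (a, u)) g); last exact: gc.
  by apply: (continuous_pairing _ (fun=> a) id) => u; [exact: cvg_cst|exact: cvg_id].
have avoid q : ~ L1 q -> exists2 M, nbhs q M & exists2 e : R, 0 < e &
    forall u L, `|u - b| < e -> F L -> L (tau u) -> L `&` M = set0 /\ ~ L q.
  move=> nL1q; have [L' FL' L'q] := leaf_through _ F_foliation q.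
  have L'L1 : L' <> L1 by move=> LL; apply: nL1q; rewrite -LL.
  have L1b : L1 (tau b) by rewrite taub.
  have [M L'M [e e0 eP]] := regular_avoid _ L' tau b L1reg FL' L'L1 tauc L1b.
  exists M; first exact: L'M.
  exists e => // u L ub FL Lu; have LM := eP u L ub FL Lu; split => // Lq.
  suff : (L `&` M) q by rewrite LM.
  by split=> //; apply: nbhs_singleton; exact: L'M.
pose sep q u := forall L s, F L -> L (tau u) -> side L s -> s q <> s p1.
pose E := [set q | ~ L1 q /\
  ~ exists2 e : R, 0 < e & (forall u, b < u -> u < b + e -> sep q u) \/
                           (forall u, b - e < u -> u < b -> sep q u)].
(* Off [L1], membership in [E] depends only on the leaves through [tau u] with [u] near [b], so
   points on the same side of all of these are interchangeable. *)
have E_transfer q q' (e : R) : 0 < e -> ~ L1 q' ->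
    (forall u L s, `|u - b| < e -> F L -> L (tau u) -> side L s -> s q = s q') ->
    E q -> E q'.
  move=> e0 nL1q' qq' [nL1q Eq]; split => // -[e' e'0 e'P]; apply: Eq.
  have [m0 me me'] : [/\ 0 < Num.min e e', Num.min e e' <= e & Num.min e e' <= e'].
    by rewrite lt_min e0 e'0 !ge_min !lexx orbT.
  exists (Num.min e e') => //.
  have sepqq' u : `|u - b| < e -> sep q' u -> sep q u.
    by move=> ub su L s FL Lu sL; rewrite (qq' u L s ub FL Lu sL); exact: su sL.
  case: e'P => e'P; [left|right] => u u1 u2; apply: sepqq'.
  - by rewrite ltr_distl; apply/andP; split; lra.
  - by apply: e'P; lra.
  - by rewrite ltr_distl; apply/andP; split; lra.
  - by apply: e'P; lra.
have E_near q : ~ L1 q -> \forall q' \near q, E q' <-> E q.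
  move=> nL1q; have [M nM [e e0 eP]] := avoid q nL1q.
  have nL1 : \forall q' \near q, ~ L1 q'.
    apply: open_nbhs_nbhs; split => //; apply: closed_openC.
    exact: leaf_closed F_foliation _ FL1.
  have [r r0 rM] := rect_nbhs _ _ (filterI nM nL1).
  have : nbhs q (rect (q.1 - r) (q.1 + r) (q.2 - r) (q.2 + r)).
    by apply: open_nbhs_nbhs; split; [exact: rect_open|exact: rect_center].
  apply: filterS => q' qr; have [Mq' nL1q'] := rM _ qr.
  have sqq' u L s : `|u - b| < e -> F L -> L (tau u) -> side L s -> s q = s q'.
    move=> ub FL Lu sL; have [LM _] := eP u L ub FL Lu.
    apply: (side_connected _ _ _ _ _ sL) qr.
    - exact/plane_convex_connected/rect_convex.
    - by apply/seteqP; split => // z [/rM[Mz _] Lz]; rewrite -LM; split.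
    - exact: rect_center.
  split; last exact: E_transfer e0 nL1q' sqq'.
  by apply: E_transfer e0 nL1q _ => u L s ub FL Lu sL; rewrite (sqq' u L s).
have E_sat : saturated F E.
  move=> L FL [q [Lq Eq]] q' Lq'.
  have [nL1q _] := Eq.
  have LL1 : L <> L1 by move=> LL; apply: nL1q; rewrite -LL.
  have nL1q' : ~ L1 q' by move=> L1q'; apply: LL1; exact: (leaf_unique _ F_foliation) L1q'.
  have [M nM [e e0 eP]] := avoid q nL1q.
  apply: (E_transfer q q' e) => // u L' s ub FL' L'u sL'.
  have [_ nL'q] := eP u L' ub FL' L'u.
  apply: (side_leaf _ F_foliation _ _ _ _ _ sL' FL' FL) => // LL.
  by apply: nL'q; rewrite -LL.
(* The leaf of [q] meets the transversal at height [v]. A leaf through [tau u] with [u] strictly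
   between [v] and [b] separates [tau v] from [p1], hence [q] from [p1]. If [v = b], then [q] lies
   on [L1]. *)
have E_off_U q : U q -> ~ E q.
  move=> Uq [nL1q Eq]; apply: Eq; pose v := (h q).2.
  have [L FL Lq] := leaf_through _ F_foliation q.
  have Lv : L (tau v) by apply: (chart_plaque _ _ _ _ Uhg _ q) => //; rewrite /tau ?hg.
  have sepE u L' s : u != v -> F L' -> L' (tau u) -> side L' s -> s q = s (tau v).
    move=> uv FL' L'u sL'; apply: (side_leaf _ F_foliation _ _ _ _ _ sL' FL' FL) => // LL.
    move/eqP: uv; apply; apply: (transversal_injective _ F_foliation _ _ _ a Uhg _ _ _ FL) => //.
    by rewrite LL.
  have [vb|bv|vb] := ltgtP v b.
  - exists (b - v); first by lra.
    right=> u u1 u2 L' s FL' L'u sL'; rewrite (sepE u L') //; last by rewrite gt_eqF //; lra.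
    rewrite -taub; apply: (transversal_sides _ F_foliation _ _ _ a Uhg _ _ u) L'u _ _ => //; lra.
  - exists (v - b); first by lra.
    left=> u u1 u2 L' s FL' L'u sL'; rewrite (sepE u L') //; last by rewrite lt_eqF //; lra.
    rewrite -taub => /esym.
    apply: (transversal_sides _ F_foliation _ _ _ a Uhg _ _ u) L'u _ _ => //; lra.
  - case: nL1q; apply: (chart_plaque _ _ _ _ Uhg _ p1) => //.
have clE_L1 q : L1 q -> ~ closure E q.
  move=> L1q clEq.
  have clEp1 : closure E p1.
    by apply: (closure_saturated _ E_sat _ FL1) => //; exists q.
  by have [z [Ez /E_off_U]] := clEp1 U (open_nbhs_nbhs (conj oU Up1)).
have nEp2 : ~ E p2.
  move=> Ep2; apply: (E_off_U _ Up1); apply/asboolP.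
  have -> : `[< E p1 >] = `[< E p2 >]; last exact/asboolP.
  apply: (connected_locally_constant _ _ setT (fun r => `[< E r >])) => //.
    by apply: plane_convex_connected => *.
  move=> q _; have [L1q|nL1q] := pselect (L1 q); last first.
    by apply: filterS (E_near q nL1q) => q' q'q _; exact: asbool_equiv_eq.
  have : \forall q' \near q, ~ closure E q'.
    apply: open_nbhs_nbhs; split; last exact: clE_L1.
    by apply: closed_openC; exact: closed_closure.
  apply: filterS => q' nq' _; rewrite !asboolF //; first by case.
  by move=> Eq'; apply: nq'; exact: subset_closure.
have nL1p2 : ~ L1 p2 by move=> L1p2; apply: L21; exact: (leaf_unique _ F_foliation) L1p2.
have [e e0 eP] : exists2 e : R, 0 < e & (forall u, b < u -> u < b + e -> sep p2 u) \/
                           (forall u, b - e < u -> u < b -> sep p2 u).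
  by apply: contrapT => ne; apply: nEp2.
(* A second bound on the interval keeps its leaves off [p2], hence distinct from [L2]. *)
have [M2 _ [e' e'0 e'P]] := avoid p2 nL1p2.
have [m0 me me'] : [/\ 0 < Num.min e e', Num.min e e' <= e & Num.min e e' <= e'].
  by rewrite lt_min e0 e'0 !ge_min !lexx orbT.
have concl u L : u != b -> `|u - b| < e' -> sep p2 u -> F L -> L (tau u) ->
    [/\ L <> L1, L <> L2 & forall s, side L s -> s p1 <> s p2].
  move=> ub ue' su FL Lu; split.
  - move=> LL; move/eqP: ub; apply; rewrite LL in Lu.
    have L1b : L1 (tau b) by rewrite taub.
    exact: (transversal_injective _ F_foliation _ _ _ a Uhg _ _ _ FL1 Lu L1b).
  - by move=> LL; have [_] := e'P u L ue' FL Lu; rewrite LL.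
  - by move=> s sL /esym; exact: su sL.
case: eP => eP.
  exists b, (b + Num.min e e'); split; first by lra.
  move=> u L bu ub; apply: concl; first by rewrite gt_eqF.
    by rewrite ltr_distl; apply/andP; split; lra.
  by apply: eP; lra.
exists (b - Num.min e e'), b; split; first by lra.
move=> u L bu ub; apply: concl; first by rewrite lt_eqF.
  by rewrite ltr_distl; apply/andP; split; lra.
by apply: eP; lra.
Qed.

End Regular.

(** * Limits of ends on the circle *)

Section Compactification.
Context {R : realType}.
Variables phi psi : plane R -> plane R.
Hypothesis phi_continuous : continuous phi.
Hypothesis psi_continuous : forall z, open_disc z -> {for z, continuous psi}.
Hypothesis phi_disc : forall q, open_disc (phi q).
Hypothesis phiK : cancel phi psi.
Hypothesis psiK : forall z, open_disc z -> phi (psi z) = z.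
Implicit Types (p q x y : plane R) (L : set (plane R)) (e : set (set (plane R))).

Lemma tends_nbhs e x N : tends phi e x -> nbhs x N ->
  exists2 K, e K & forall q, K q -> N (phi q).
Proof. by move=> ex /ex[K eK KN]; exists K. Qed.

Lemma plane_separate p q : p <> q -> exists A B,
  [/\ nbhs p A, nbhs q B & forall r, A r -> B r -> False].
Proof.
move=> /eqP pq; have := @plane_hausdorff R; rewrite open_hausdorff.
move=> /(_ p q pq)[[A B] /= [pA qB] [oA oB /eqP AB]].
rewrite !inE in pA qB; exists A, B; split; try exact: open_nbhs_nbhs.
by move=> r Ar Br; have : (A `&` B) r by []; rewrite AB.
Qed.

Lemma open_disc_open : open (@open_disc R).
Proof.
pose f (z : plane R) := z.1 ^+ 2 + z.2 ^+ 2.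
have sqc : continuous (fun r : R => r ^+ 2) by exact: exprn_continuous.
have fc : continuous f.
  move=> z; apply: (@continuousD _ R _ (fun z : plane R => z.1 ^+ 2) (fun z : plane R => z.2 ^+ 2)).
    by apply: (@continuous_comp _ _ _ fst (fun r : R => r ^+ 2)); [exact: cvg_fst|exact: sqc].
  by apply: (@continuous_comp _ _ _ snd (fun r : R => r ^+ 2)); [exact: cvg_snd|exact: sqc].
have -> : @open_disc R = f @^-1` [set r | r < 1] by [].
by apply: open_comp; [move=> z _; exact: fc|exact: open_lt].
Qed.

Lemma open_disc_convex : plane_convex (@open_disc R).
Proof.
move=> p q t; rewrite /open_disc /segment_point /= => p1 q1 t0 t1.
have : 0 <= t * (1 - t) * ((p.1 - q.1) ^+ 2 + (p.2 - q.2) ^+ 2).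
  by apply: mulr_ge0; [apply: mulr_ge0; lra|rewrite addr_ge0 // sqr_ge0].
have : (1 - t) * (p.1 ^+ 2 + p.2 ^+ 2) + t * (q.1 ^+ 2 + q.2 ^+ 2) < 1.
  have [->|tn0] := eqVneq t 0; first by lra.
  have t_gt0 : 0 < t by rewrite lt_neqAle eq_sym tn0.
  have : t * (q.1 ^+ 2 + q.2 ^+ 2) < t * 1 by rewrite ltr_pM2l.
  have : (1 - t) * (p.1 ^+ 2 + p.2 ^+ 2) <= (1 - t) * 1.
    by apply: ler_wpM2l; [lra|exact: ltW].
  lra.
rewrite !expr2; lra.
Qed.

Lemma circle_limit y M : circle y -> nbhs y M -> exists q, M (phi q).
Proof.
move=> y1 My; have : nbhs (1 : R) [set r : R | M (r * y.1, r * y.2)].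
  have : continuous (fun r : R => (r * y.1, r * y.2)).
    apply: (continuous_pairing _ (fun r : R => r * y.1) (fun r : R => r * y.2)) => r;
      by apply: (@continuousM _ R id (fun=> _)); [exact: cvg_id|exact: cvg_cst].
  by move=> /(_ 1); apply; rewrite !mul1r -surjective_pairing.
move=> /nbhs_ballP[d /= d0 dM].
pose m := Num.min d 1.
have [m0 md m1] : [/\ 0 < m, m <= d & m <= 1].
  by rewrite lt_min d0 ltr01 !ge_min !lexx orbT.
have disc : open_disc ((1 - m / 2) * y.1, (1 - m / 2) * y.2).
  rewrite /open_disc /= !exprMn -mulrDr y1 mulr1 expr2; nra.
exists (psi ((1 - m / 2) * y.1, (1 - m / 2) * y.2)); rewrite psiK //.
by apply: (dM (1 - m / 2)); rewrite /ball /= opprB addrCA subrr addr0 gtr0_norm; lra.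
Qed.

(** The tails of [L] stay near [y1] and [y2], and the compact remainder has compact image inside the
    open disc. *)
Lemma leaf_avoids L e1 e2 y y1 y2 : leaf_end L e1 -> leaf_end L e2 -> e1 <> e2 ->
  tends phi e1 y1 -> tends phi e2 y2 -> circle y -> y <> y1 -> y <> y2 ->
  \forall z \near y, forall q, phi q = z -> ~ L q.
Proof.
move=> h1 h2 e12 t1 t2 cy yy1 yy2.
have [A1 [B1 [A1y B1y AB1]]] := plane_separate _ _ yy1.
have [A2 [B2 [A2y B2y AB2]]] := plane_separate _ _ yy2.
have [K1 e1K1 K1B] := tends_nbhs _ _ _ t1 B1y.
have [K2 e2K2 K2B] := tends_nbhs _ _ _ t2 B2y.
have [C Cc LC] := leaf_end_cover _ _ _ _ _ h1 h2 e12 e1K1 e2K2.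
have : \forall z \near y, ~ (phi @` C) z.
  apply: open_nbhs_nbhs; split.
    apply/closed_openC/(compact_closed plane_hausdorff)/continuous_compact => //.
    exact: continuous_subspaceT.
  by move=> [q _ qy]; have := phi_disc q; rewrite qy /open_disc /= cy ltxx.
apply: filterS3 A1y A2y => z A1z A2z Cz q qz /LC[[Cq|/K1B]|/K2B].
- by apply: Cz; exists q.
- by rewrite qz; exact: AB1.
- by rewrite qz; exact: AB2.
Qed.

(** A small square around [y] meets the disc in a convex set, whose preimage is connected and misses
    [L]. *)
Lemma side_near_circle L s y : side L s ->
  (\forall z \near y, forall q, phi q = z -> ~ L q) ->
  exists2 N, nbhs y N & forall q q', N (phi q) -> N (phi q') -> s q = s q'.
Proof.
move=> sL /rect_nbhs[r r0 rP].
exists (rect (y.1 - r) (y.1 + r) (y.2 - r) (y.2 + r)).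
  by apply: open_nbhs_nbhs; split; [exact: rect_open|exact: rect_center].
set N := rect _ _ _ _ => q q' Nq Nq'.
have cA : connected (psi @` (N `&` @open_disc R)).
  apply: connected_continuous_connected.
    apply: plane_convex_connected => a b t [Na da] [Nb db] t0 t1; split.
      exact: rect_convex.
    exact: open_disc_convex.
  apply: continuous_in_subspaceT => z; rewrite inE => -[_ dz].
  exact: psi_continuous.
apply: (side_connected _ _ _ _ _ sL cA).
- apply/seteqP; split => // _ [[z [Nz dz] <-]].
  exact: (rP z Nz _ (psiK _ dz)).
- by exists (phi q).
- by exists (phi q').
Qed.

Lemma circle_punctured_connected x : circle x -> connected (@circle R `\` [set x]).
Proof.
case: x => a b; rewrite /circle /= => ab1.
(* Stereographic parametrization of the circle minus (1, 0), rotated by x. *)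
pose z1 (t : R) := (t ^+ 2 - 1) / (t ^+ 2 + 1).
pose z2 (t : R) := t * 2 / (t ^+ 2 + 1).
have den (t : R) : t ^+ 2 + 1 != 0 by rewrite gt_eqF // ltr_wpDl // sqr_ge0.
have z12 t : z1 t ^+ 2 + z2 t ^+ 2 = 1.
  by rewrite /z1 /z2; field; rewrite den.
have -> : [set z : plane R | z.1 ^+ 2 + z.2 ^+ 2 = 1] `\` [set (a, b)] =
    (fun t => (a * z1 t - b * z2 t, a * z2 t + b * z1 t)) @` [set: R].
  apply/seteqP; split => [[u v] /= [uv1 uvab]|_ [t _ <-]].
    (* [(w1, w2)] is [(u, v)] turned by the rotation taking [(a, b)] to [(1, 0)], and
       [w2 / (1 - w1)] is its stereographic projection. *)
    pose w1 := a * u + b * v; pose w2 := a * v - b * u.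
    have w12 : w1 ^+ 2 + w2 ^+ 2 = 1.
      transitivity ((a ^+ 2 + b ^+ 2) * (u ^+ 2 + v ^+ 2)); first by rewrite /w1 /w2; ring.
      by rewrite ab1 uv1 mulr1.
    have ua : a * w1 - b * w2 = u.
      transitivity ((a ^+ 2 + b ^+ 2) * u); first by rewrite /w1 /w2; ring.
      by rewrite ab1 mul1r.
    have vb : a * w2 + b * w1 = v.
      transitivity ((a ^+ 2 + b ^+ 2) * v); first by rewrite /w1 /w2; ring.
      by rewrite ab1 mul1r.
    have w1n : 1 - w1 != 0.
      apply/eqP => w1E; apply: uvab.
      have w11 : w1 = 1 by lra.
      have /eqP : w2 ^+ 2 = 0 by move: w12; rewrite w11; lra.
      rewrite sqrf_eq0 => /eqP w20.
      by rewrite -ua -vb w11 w20 !mulr1 !mulr0 subr0 add0r.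
    have w2E : w2 ^+ 2 = (1 - w1) * (1 + w1) by rewrite -subr_sqr expr1n -w12 addrC addKr.
    exists (w2 / (1 - w1)) => //.
    have tE : (w2 / (1 - w1)) ^+ 2 = (1 + w1) / (1 - w1).
      by rewrite expr_div_n w2E; field.
    have z1E : z1 (w2 / (1 - w1)) = w1 by rewrite /z1 tE; field; rewrite w1n; lra.
    have z2E : z2 (w2 / (1 - w1)) = w2 by rewrite /z2 tE; field; rewrite w1n; lra.
    by rewrite z1E z2E ua vb.
  split => /=.
    transitivity ((a ^+ 2 + b ^+ 2) * (z1 t ^+ 2 + z2 t ^+ 2)); first by ring.
    by rewrite ab1 z12 mulr1.
  move=> [e1 e2].
  have : z1 t = 1.
    transitivity ((a ^+ 2 + b ^+ 2) * z1 t); first by rewrite ab1 mul1r.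
    transitivity (a * (a * z1 t - b * z2 t) + b * (a * z2 t + b * z1 t)); first by ring.
    by rewrite e1 e2 -ab1; ring.
  rewrite /z1 => /(congr1 (fun r => r * (t ^+ 2 + 1))); rewrite mulfVK // mul1r; lra.
have sqc : continuous (fun t : R => t ^+ 2) by exact: exprn_continuous.
have denc t : {for t, continuous (fun t : R => (t ^+ 2 + 1)^-1)}.
  apply: (@continuousV _ _ (fun t : R => t ^+ 2 + 1)) => //.
  apply: (@continuousD _ R R (fun t : R => t ^+ 2) (fun=> 1)); first exact: sqc.
  exact: cvg_cst.
have z1c : continuous z1.
  move=> t; apply: (@continuousM _ _ (fun t : R => t ^+ 2 - 1)) => //.
  apply: (@continuousB _ R R (fun t : R => t ^+ 2) (fun=> 1)); first exact: sqc.
  exact: cvg_cst.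
have z2c : continuous z2.
  move=> t; apply: (@continuousM _ _ (fun t : R => t * 2)) => //.
  by apply: (@continuousM _ _ id (fun=> 2)); [exact: cvg_id|exact: cvg_cst].
have mulc (k : R) (f : R -> R) : continuous f -> continuous (fun t => k * f t).
  by move=> fc t; apply: (@continuousM _ _ (fun=> k)); [exact: cvg_cst|exact: fc].
apply: connected_continuous_connected.
  by apply/connected_intervalP.
apply: continuous_subspaceT; apply: continuous_pairing => t.
  by apply: (@continuousB _ R R (fun t => a * z1 t)); apply: mulc.
by apply: (@continuousD _ R R (fun t => a * z2 t)); apply: mulc.
Qed.

Variable F : set (set (plane R)).
Hypothesis F_foliation : foliation F.
Hypothesis F_ends : forall L e, F L -> leaf_end L e ->
  exists2 x, circle x & tends phi e x.

Lemma separating_leaf_end L L1 L2 s (p1 p2 : plane R) e1 e2 x :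
  F L -> F L1 -> F L2 -> L <> L1 -> L <> L2 -> side L s -> L1 p1 -> L2 p2 ->
  s p1 <> s p2 -> circle x -> leaf_end L1 e1 -> leaf_end L2 e2 ->
  tends phi e1 x -> tends phi e2 x -> exists2 e, leaf_end L e & tends phi e x.
Proof.
move=> FL FL1 FL2 LL1 LL2 sL L1p1 L2p2 sp12 cx he1 he2 t1 t2.
have [l lp Ll] := leaf_line _ F_foliation _ FL.
have [f1 [f2 [hf1 hf2 f12]]] := two_leaf_ends _ lp.
rewrite -Ll in hf1 hf2.
have [y1 _ ty1] := F_ends _ _ FL hf1; have [y2 _ ty2] := F_ends _ _ FL hf2.
have [<-|xy1] := pselect (y1 = x); first by exists f1.
have [<-|xy2] := pselect (y2 = x); first by exists f2.
exfalso; apply: sp12.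
have xL := leaf_avoids _ _ _ _ _ _ hf1 hf2 f12 ty1 ty2 cx (nesym xy1) (nesym xy2).
have [N Nx sN] := side_near_circle _ _ _ sL xL.
(* [L'] lies on one side of [L], so the side of [p] can be read at a point of [L'] far out along the
   end, inside [N]. *)
have sNk L' e p : F L' -> L <> L' -> L' p -> leaf_end L' e -> tends phi e x ->
    exists2 k, N (phi k) & s p = s k.
  move=> FL' LL' L'p he te; have [K eK KN] := tends_nbhs _ _ _ te Nx.
  have hK := leaf_end_half_leaf _ _ _ he eK; have [k Kk] := half_leaf_nonempty _ _ hK.
  exists k; first exact: KN.
  apply: (side_leaf _ F_foliation _ _ _ _ _ sL FL FL' (nesym LL')) => //.
  exact: half_leaf_sub hK k Kk.
have [k1 Nk1 ->] := sNk _ _ _ FL1 LL1 L1p1 he1 t1.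
have [k2 Nk2 ->] := sNk _ _ _ FL2 LL2 L2p2 he2 t2.
exact: sN.
Qed.

(** Near each [y] other than [x] the leaf is absent and [s] is constant; that constant is
    independent of [y] because the circle minus a point is connected. *)
Lemma side_constant_at_infinity L s e1 e2 x :
  F L -> side L s -> leaf_end L e1 -> leaf_end L e2 -> e1 <> e2 -> circle x ->
  tends phi e1 x -> tends phi e2 x ->
  exists b : bool, forall y, circle y -> y <> x ->
    \forall z \near y, forall q, phi q = z -> s q = b.
Proof.
move=> FL sL h1 h2 e12 cx t1 t2.
have ex y : exists b : bool, circle y -> y <> x ->
    \forall z \near y, forall q, phi q = z -> s q = b.
  have [[cy yx]|ncy] := pselect (circle y /\ y <> x); last first.
    by exists true => cy yx; case: ncy.
  have yL := leaf_avoids _ _ _ _ _ _ h1 h2 e12 t1 t2 cy yx yx.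
  have [N Ny sN] := side_near_circle _ _ _ sL yL.
  have [q0 Nq0] := circle_limit _ _ cy Ny.
  exists (s q0) => _ _; apply: filterS Ny => z Nz q qz.
  by apply: sN => //; rewrite qz.
have [c cP] := choice ex.
have cloc y : (@circle R `\` [set x]) y ->
    \forall y' \near y, (@circle R `\` [set x]) y' -> c y' = c y.
  move=> [cy yx]; have /nbhs_interior := cP y cy yx.
  apply: filterS => y' hy' [cy' y'x].
  (* Values attached to neighbouring points of the circle are compared at an interior point in both
     neighbourhoods. *)
  have [q] := circle_limit _ _ cy' (filterI hy' (cP y' cy' y'x)).
  by move=> [/(_ q erefl) <- /(_ q erefl) <-].
have [[y0 Cy0]|nC] := pselect (exists y, (@circle R `\` [set x]) y); last first.
  by exists true => y cy yx; case: nC; exists y.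
exists (c y0) => y cy yx.
rewrite (connected_locally_constant _ _ _ c (circle_punctured_connected _ cx) cloc y0 y) //.
exact: cP.
Qed.

Lemma returning_leaf_ends L e1 e2 x U h g p :
  F L -> leaf_end L e1 -> leaf_end L e2 -> e1 <> e2 -> circle x ->
  tends phi e1 x -> tends phi e2 x -> chart F U h g -> U p -> L p ->
  exists c d : R, c < d /\ forall u L', c < u -> u < d ->
    F L' -> L' (g ((h p).1, u)) -> exists2 e, leaf_end L' e & tends phi e x.
Proof.
move=> FL h1 h2 e12 cx t1 t2 Uhg Up Lp.
have [s sL] := leaf_side _ F_foliation _ FL.
have [b bP] := side_constant_at_infinity _ _ _ _ _ FL sL h1 h2 e12 cx t1 t2.
case: (Uhg) => _ _ _ _ [gU gh hg].
set a := (h p).1; pose v := (h p).2.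
have Lv : L (g (a, v)) by rewrite /a /v -surjective_pairing gh.
(* A leaf on the side other than [b] cannot approach any [y] distinct from [x], near which only the
   value [b] occurs. *)
have ends u L' : u != v -> s (g (a, u)) <> b -> F L' -> L' (g (a, u)) ->
    exists2 e, leaf_end L' e & tends phi e x.
  move=> uv su FL' L'u; have [l lp L'l] := leaf_line _ F_foliation _ FL'.
  have [e [_ [he _ _]]] := two_leaf_ends _ lp; rewrite -L'l in he.
  have [y cy ty] := F_ends _ _ FL' he.
  have [yx|yx] := pselect (y = x); first by exists e => //; rewrite -yx.
  have [K eK KN] := tends_nbhs _ _ _ ty (bP y cy yx).
  have hK := leaf_end_half_leaf _ _ _ he eK; have [k Kk] := half_leaf_nonempty _ _ hK.
  exfalso; apply: su; rewrite -(KN k Kk k erefl).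
  apply: (side_leaf _ F_foliation _ _ _ _ _ sL FL FL') => //.
    move=> LL; move/eqP: uv; apply.
    by apply: (transversal_injective _ F_foliation _ _ _ a Uhg _ _ _ FL) => //; rewrite -LL.
  exact: half_leaf_sub hK k Kk.
have sides u1 u2 := transversal_sides _ F_foliation _ _ _ a Uhg _ _ v u1 u2 FL sL Lv.
(* The transversal meets [L] only at [v], so [v - 1] and [v + 1] are arbitrary samples of the two
   sides; the interval is taken where [s] differs from [b]. *)
have [sb|/eqP sb] := eqVneq (s (g (a, v - 1))) b.
  exists v, (v + 1); split; first by lra.
  move=> u L' vu _; apply: ends; first by rewrite gt_eqF.
  by move=> su; apply: (sides (v - 1) u) => //; [lra|rewrite sb su].
exists (v - 1), v; split; first by lra.
move=> u L' _ uv; apply: ends; first by rewrite lt_eqF.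
move=> su; have s1 := sides u (v + 1) uv; have s2 := sides (v - 1) (v + 1).
have v1 : v < v + 1 by lra.
have v2 : v - 1 < v by lra.
move: (s1 v1) (s2 v2 v1) sb; rewrite su.
by case: (s (g (a, v + 1))) (s (g (a, v - 1))) (b) => [] [] [].
Qed.

End Compactification.

(** * Counting the ends of leaves along a transversal, and the conclusion *)

Lemma itv_uncountable {R : realType} (c d : R) : c < d -> ~ countable `]c, d[%classic.
Proof.
move=> cd /countable_lebesgue_measure0; rewrite lebesgue_measure_itv /= lte_fin cd.
by rewrite -EFinB => /eqP; rewrite eqe subr_eq0 gt_eqF.
Qed.

(** Choosing for each parameter an end in [A] of its leaf is injective: an end contains a nonempty
    half leaf, which determines the leaf, and the leaf meets [tau] at one parameter. *)
Lemma transversal_ends_uncountable {R : realType} (F : set (set (plane R)))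
    (tau : R -> plane R) (c d : R) (A : set (set (set (plane R)))) :
  foliation F -> c < d ->
  (forall L u v, F L -> L (tau u) -> L (tau v) -> u = v) ->
  (forall u L, c < u -> u < d -> F L -> L (tau u) -> exists2 e, leaf_end L e & A e) ->
  ~ countable A.
Proof.
move=> hF cd tau_inj tau_ends Acount.
have ex u : exists e, c < u < d -> A e /\ exists L, [/\ F L, L (tau u) & leaf_end L e].
  have [/andP[cu ud]|ncud] := pselect (c < u < d); last by exists set0 => /ncud.
  have [L FL Lu] := leaf_through _ hF (tau u).
  by have [e he Ae] := tau_ends u L cu ud FL Lu; exists e => _; split => //; exists L.
have [f fP] := choice ex.
apply: (itv_uncountable c d cd).
have f_inj : {in `]c, d[%classic &, injective f}.
  move=> u v; rewrite !inE /= !in_itv /= => /fP[_ [L [FL Lu Le]]] /fP[_ [L' [FL' L'v L'e]]] fuv.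
  have [K eK] := leaf_end_nonempty _ _ Le.
  have hK := leaf_end_half_leaf _ _ _ Le eK.
  rewrite fuv in eK; have hK' := leaf_end_half_leaf _ _ _ L'e eK.
  have [k Kk] := half_leaf_nonempty _ _ hK.
  have LL' : L = L'.
    exact: (leaf_unique _ hF _ _ _ FL FL' (half_leaf_sub _ _ hK k Kk) (half_leaf_sub _ _ hK' k Kk)).
  by apply: (tau_inj L) => //; rewrite LL'.
rewrite /countable -(card_le_eql (inj_card_eq f_inj)).
apply: sub_countable Acount; apply: subset_card_le => _ [u + <-].
by rewrite /= in_itv /= => /fP[].
Qed.

Theorem proposition1p1 (R : realType) (I : set nat)
    (F : nat -> set (set (plane R)))
    (F_foliation : forall i, I i -> foliation (F i))
    (F_transverse : forall i j, I i -> I j -> i <> j -> transverse (F i) (F j))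
    (phi : plane R -> plane R) (phi_F : family_compactification I F phi)
    (i : nat) (Ii : I i) (L1 L2 : set (plane R))
    (L1_regular : regular_leaf (F i) L1) (L2_regular : regular_leaf (F i) L2)
    (e1 e2 : set (set (plane R)))
    (e1_end : leaf_end L1 e1) (e2_end : leaf_end L2 e2) (e1_neq_e2 : e1 <> e2) :
  exists x1 x2 : plane R,
    [/\ circle x1, circle x2, tends phi e1 x1, tends phi e2 x2 & x1 <> x2].
Proof.
case: phi_F => -[psi [phic psic phi_disc _ [phiK psiK]]] ends ends_countable _.
have hF := F_foliation i Ii; have FL1 := L1_regular.1; have FL2 := L2_regular.1.
have F_ends L e : F i L -> leaf_end L e -> exists2 x, circle x & tends phi e x.
  by move=> FL he; apply: ends; exists i, L.
have [x1 cx1 t1] := F_ends _ _ FL1 e1_end; have [x2 cx2 t2] := F_ends _ _ FL2 e2_end.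
exists x1, x2; split => // x12; rewrite -x12 {x2 x12 cx2} in t2.
have phi_continuous : continuous phi by apply/continuous_subspace_setT.
have psi_continuous z : open_disc z -> {for z, continuous psi}.
  move=> dz; move: psic; rewrite continuous_open_subspace; last exact: open_disc_open.
  by apply; rewrite inE.
have {}phi_disc q : open_disc (phi q) by exact: phi_disc.
have {}phiK : cancel phi psi by move=> q; apply: phiK; rewrite inE.
have {}psiK z : open_disc z -> phi (psi z) = z by move=> dz; apply: psiK; rewrite inE.
have leaf_nonempty L : F i L -> L !=set0 by case: hF => -[_ _ +] _ _; exact.
have [p1 L1p1] := leaf_nonempty L1 FL1.
have [p2 L2p2] := leaf_nonempty L2 FL2.
have [U [h [g [Uhg Up1]]]] := chart_exists _ hF p1.
have [c [d [cd cdP]]] : exists c d : R, c < d /\ forall u L, c < u -> u < d ->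
    F i L -> L (g ((h p1).1, u)) -> exists2 e, leaf_end L e & tends phi e x1.
  have [L12|L12] := pselect (L2 = L1).
    rewrite L12 in e2_end.
    exact: (returning_leaf_ends _ psi phi_continuous psi_continuous phi_disc phiK psiK
      _ hF F_ends L1 e1 e2 _ _ _ _ _ FL1 e1_end e2_end e1_neq_e2 cx1 t1 t2 Uhg).
  have [c [d [cd cdP]]] :=
    regular_separates _ hF _ _ _ _ _ _ _ L1_regular FL2 L12 Uhg Up1 L1p1 L2p2.
  exists c, d; split => // u L cu ud FL Lu; have [LL1 LL2 Lsep] := cdP u L cu ud FL Lu.
  have [s sL] := leaf_side _ hF _ FL.
  exact: (separating_leaf_end _ psi phi_continuous psi_continuous phi_disc phiK psiK
    _ hF F_ends L L1 L2 s p1 p2 e1 e2 x1 FL FL1 FL2 LL1 LL2 sL L1p1 L2p2 (Lsep s sL)).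
(* An interval of parameters now gives uncountably many ends at [x1], against the countability
   clause at [x1]. *)
apply: (transversal_ends_uncountable _ (fun u => g ((h p1).1, u)) _ _ _ hF cd _ _
  (ends_countable x1 cx1)).
  by move=> L u v FL; exact: (transversal_injective _ hF _ _ _ _ Uhg _ _ _ FL).
move=> u L cu ud FL Lu; have [e he te] := cdP u L cu ud FL Lu.
by exists e => //; split => //; exists i, L.
Qed.
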